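(* Let $p$ be an odd prime, $q$ a power of $p$, $\ell$ an odd prime with $\ell\ne p$, $m,n$ positive integers, and $f=\mathrm{ord}_\ell(q)$. (i) If $q\equiv1\pmod 4$, the LCD negacyclic codes of length $2\ell^mp^n$ over $\mathbb F_q$ are exactly the codes generated by $\prod_{i=0}^{e}\hat M_{\rho_i}(\beta X)^{\varepsilon_i}\hat M_{-\rho_i}(-\beta X)^{\varepsilon_i}$ with $\varepsilon_i\in\{0,p^n\}$, and there are exactly $2^{e+1}$ of them. (ii) If $q\equiv3\pmod4$ and $f$ is odd, the LCD negacyclic codes of length $2\ell^mp^n$ over $\mathbb F_q$ are exactly the codes generated by $$(X^2+1)^{\varepsilon_0}\prod_{r=1}^{m}\prod_{k=0}^{\frac{\delta(r)}{2}-1}I_{r,k}(X)^{\varepsilon_k^r}J_{r,k}(X)^{\varepsilon_k^r},\qquad\varepsilon_0,\varepsilon_k^r\in\{0,p^n\},$$ where $I_{r,k}(X)=\hat M_{\ell^{m-r}g^k}(\theta X)\hat M_{\ell^{m-r}g^k}(-\theta X)$ and $J_{r,k}(X)=\hat M_{-\ell^{m-r}g^k}(\theta X)\hat M_{-\ell^{m-r}g^k}(-\theta X)$, and there are exactly $2^{1+\frac e2}$ of them. (iii) If $q\equiv3\pmod4$ and $f\equiv2\pmod4$, the LCD negacyclic codes of length $2\ell^mp^n$ over $\mathbb F_q$ are exactly the codes generated by $(X^2+1)^{\varepsilon_0}\prod_{k=1}^{e}S_k(X)^{\varepsilon_k}T_k(X)^{\epsilon_k}$ with $\varepsilon_0,\varepsilon_k,\epsilon_k\in\{0,p^n\}$,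 where $S_k(X)=\hat N_{\rho_k}(\theta X)\hat N_{\rho_kq}(-\theta X)$ and $T_k(X)=\hat N_{\rho_k}(-\theta X)\hat N_{\rho_kq}(\theta X)$; there are exactly $2^{1+2e}$ of them. (iv) If $q\equiv3\pmod4$ and $f\equiv0\pmod4$, the LCD negacyclic codes of length $2\ell^mp^n$ over $\mathbb F_q$ are exactly the codes generated by $(X^2+1)^{\varepsilon_0}\prod_{k=1}^{e}S_k(X)^{\varepsilon_k}T_k(X)^{\varepsilon_k}$ with $\varepsilon_0,\varepsilon_k\in\{0,p^n\}$ ($S_k,T_k$ as in (iii)); there are exactly $2^{1+e}$ of them.
   Context: A negacyclic code of length $N$ over $\mathbb F_q$ is an ideal of $\mathbb F_q[X]/\langle X^N+1\rangle$; the code generated by $g(X)$ is the ideal generated by its image. A linear code $C$ is LCD if $C\cap C^\perp=\{0\}$ ($C^\perp$ the Euclidean dual). For a nonzero polynomial $h$ with leading coefficient $c$, $\hat h=c^{-1}h$. For an integer $t$, $C_t=\{tq^i\bmod\ell^m:i\ge0\}$; $\rho_0=0,\rho_1,\dots,\rho_e$ are representatives of all distinct $q$-cyclotomic cosets modulo $\ell^m$. $\eta$ is a primitive $\ell^m$-th root of unity in an extension of $\mathbb F_q$, $M_t(X)=\prod_{s\in C_t}(X-\eta^s)$. When $f$ is even, $D_t=\{tq^{2i}\bmod\ell^m:i\ge0\}$, $C_{\rho_k}=D_{\rho_k}\cup D_{\rho_kq}$ (disjoint) for $1\le k\le e$, and $N_t(X)=\prod_{s\in D_t}(X-\eta^s)$.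 $g$ is a fixed generator of $\mathbb Z_{\ell^m}^*$, $\lambda(r)=\mathrm{ord}_{\ell^r}(q)$, $\delta(r)=\phi(\ell^r)/\lambda(r)$. If $q\equiv1\pmod4$: $\gamma\in\mathbb F_q$ is a primitive fourth root of unity and $\beta\in\mathbb F_q$ satisfies $\beta^{\ell^m}\gamma=1$ and $\beta^{-1}=-\beta$. If $q\equiv3\pmod4$: $\varsigma\in\mathbb F_{q^2}$ satisfies $\varsigma^2=-1$, and $\theta\in\mathbb F_{q^2}$ satisfies $\theta^{\ell^m}\varsigma=1$ and $\theta^{-1}=\theta^q=-\theta$. *)

(* Defs.v *)
From HB Require Import structures.
From mathcomp Require Import all_boot all_order all_algebra all_field.
Set Implicit Arguments. Unset Strict Implicit. Unset Printing Implicit Defensive.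
Import GRing.Theory.
Local Open Scope ring_scope.

(* multiplicative order of a modulo k (k >= 2, coprime a k): least i >= 1 with
   a^i = 1 mod k.  Since the order is <= totient k < k, searching 1..k suffices. *)
Definition ordn (k a : nat) : nat :=
  (find (fun i => (a ^ i.+1 %% k == 1 %% k)%N) (iota 0 k)).+1.

Definition negm (k t : nat) : nat := ((k - t %% k) %% k)%N.

(* q-cyclotomic coset C_t = {t q^i mod k : i >= 0}, as a duplicate-free list.
   (q coprime to k, so q^i mod k is periodic of period < k: i < k suffices.) *)
Definition cyc (k q t : nat) : seq nat :=
  undup [seq ((t * q ^ i) %% k)%N | i <- iota 0 k].

(* M_t(X) = prod_{s in C_t} (X - eta^s) (with q replaced by q^2 this is N_t) *)
Definition Mpoly (L : fieldType) (eta : L) (k q t : nat) : {poly L} :=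
  \prod_(s <- cyc k q t) ('X - (eta ^+ s)%:P).

Definition hatp (L : fieldType) (h : {poly L}) : {poly L} := (lead_coef h)^-1 *: h.

Definition scalX (L : fieldType) (h : {poly L}) (c : L) : {poly L} := h \Po (c *: 'X).

(* The ring R = F[X]/<X^N+1> is identified with F^N = 'rV_N via coefficients. *)

Definition poly_of_row (F : fieldType) (N : nat) (u : 'rV[F]_N) : {poly F} :=
  \sum_(i < N) u 0 i *: 'X^i.

Definition row_of_poly (F : fieldType) (N : nat) (h : {poly F}) : 'rV[F]_N :=
  \row_(i < N) (h %% ('X^N + 1))`_i.

Definition negmul (F : fieldType) (N : nat) (u v : 'rV[F]_N) : 'rV[F]_N :=
  row_of_poly N (poly_of_row u * poly_of_row v).

Definition negacyclic (F : finFieldType) (N : nat) (C : {set 'rV[F]_N}) : bool :=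
  [&& 0 \in C,
      [forall u in C, forall v in C, u + v \in C] &
      [forall a, forall u in C, negmul a u \in C]].

Definition gen_code (F : finFieldType) (N : nat) (g : {poly F}) : {set 'rV[F]_N} :=
  [set v : 'rV[F]_N | [exists a : 'rV[F]_N, v == negmul (row_of_poly N g) a]].

Definition dual_code (F : finFieldType) (N : nat) (C : {set 'rV[F]_N}) : {set 'rV[F]_N} :=
  [set v : 'rV[F]_N | [forall c in C, (v *m c^T) 0 0 == 0]].

Definition LCD (F : finFieldType) (N : nat) (C : {set 'rV[F]_N}) : bool :=
  C :&: dual_code C == [set 0].

Definition LCD_negacyclic (F : finFieldType) (N : nat) (C : {set 'rV[F]_N}) : bool :=
  negacyclic C && LCD C.

(* Main.v *)
(** Write [k = l^m], [d = 2 k] and [pn = p^n], so that [X^N + 1 = (X^d + 1)^pn].  Euclidean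
    duality is the coefficient pairing [(u, v) |-> u v*], where [v*] is the reciprocal of [v];
    hence if [g g' = X^N + 1], the code generated by [g] is LCD iff [g] is coprime to [g'] and
    associated to its reciprocal.  As [X^d + 1] is separable, such a [g] is the [pn]-th power of
    a product of linear factors over a set of roots of [X^d + 1] closed under [x |-> x^q] and
    [x |-> x^-1].  So the LCD codes correspond to the sets of orbits of these two maps.

    If [c^2 = -1], the roots are [+-c^-1 eta^t] with [t] modulo [k].  The [q]-power map sends
    [(sign, t)] to [(sign, q t)] or [(-sign, q t)] according to [q] modulo 4, and inversion
    sends it to [(-sign, -t)].  The orbits then depend on whether [-1] is a power of [q] modulo
    [k] and on the parity of the exponent, which is read off [f] by lifting congruences from [l]
    to [l^m].  When [f] is odd, the cosets of [<q>] are enumerated with a primitive root. *)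
Require Import Defs.
From HB Require Import structures.
From mathcomp Require Import all_boot all_order all_algebra all_field.
From mathcomp Require Import cyclic zify ring.
Import GRing.Theory.
Set Implicit Arguments. Unset Strict Implicit. Unset Printing Implicit Defensive.
Local Open Scope ring_scope.

(** * Reciprocal polynomials *)

(** All four cases are instances of one statement: given representatives of the orbits and
    duplicate-free lists of their points, the LCD codes are the selections of orbits. A case only
    has to describe its orbits. The sign is what separates the cases. When [c ^+ q = - c], each step
    along a coset of [q] flips it, and so does inversion. If [f] is odd, some odd power of [q] is 1
    modulo [k], so both signs over a coset lie in one orbit, while [-1] is not a power of [q] and
    opposite cosets get paired: e/2 nonzero orbits. If [f] is even, [-1 = q^h] with [h] of the
    parity of f/2. For odd [h], inversion is itself the [q^h]-power map, and each nonzero coset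
    carries two orbits; for even [h], inversion joins these two. Over [t = 0] the two points always
    form one orbit, whence the factor X^2 + 1. [recip] takes the length as a parameter because
    codewords are reversed at length N, generators at their own degree, and products mix the two. *)

Definition recip (F : fieldType) (n : nat) (f : {poly F}) : {poly F} :=
  \poly_(i < n.+1) f`_(n - i).

Section Reciprocal.
Variable F : fieldType.
Implicit Types f g : {poly F}.

Lemma size_recip n f : (size (recip n f) <= n.+1)%N.
Proof. exact: size_poly. Qed.

Lemma coef_recip n f i : (recip n f)`_i = if (i <= n)%N then f`_(n - i) else 0.
Proof. by rewrite coef_poly ltnS. Qed.

Lemma recipE n f : recip n f = \sum_(i < n.+1) f`_i *: 'X^(n - i).
Proof.
rewrite /recip poly_def (reindex_inj rev_ord_inj) /=.
by apply: eq_bigr => i _; rewrite subSS subKn // -ltnS.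
Qed.

Lemma recipD n f g : recip n (f + g) = recip n f + recip n g.
Proof. by apply/polyP=> i; rewrite !(coefD, coef_recip); case: ifP; rewrite ?addr0 ?coefD. Qed.

Lemma recipZ n c f : recip n (c *: f) = c *: recip n f.
Proof. by apply/polyP=> i; rewrite !(coefZ, coef_recip); case: ifP; rewrite ?mulr0 ?coefZ. Qed.

Lemma recip0 n : recip n (0 : {poly F}) = 0.
Proof. by apply/polyP=> i; rewrite coef_recip !coef0 if_same. Qed.

Lemma recipXn n i : (i <= n)%N -> recip n ('X^i : {poly F}) = 'X^(n - i).
Proof.
move=> le_in; apply/polyP=> j; rewrite coef_recip !coefXn.
case: leqP => [le_jn | lt_nj]; first by congr (_%:R); lia.
by have /negPf-> : (j != n - i)%N by lia.
Qed.

Lemma recip_sum n I (r : seq I) (G : I -> {poly F}) :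
  recip n (\sum_(i <- r) G i) = \sum_(i <- r) recip n (G i).
Proof.
elim: r => [|i r IH]; first by rewrite !big_nil recip0.
by rewrite !big_cons recipD IH.
Qed.

Lemma poly_sum_le n f : (size f <= n.+1)%N -> f = \sum_(i < n.+1) f`_i *: 'X^i.
Proof.
move=> sf; rewrite -poly_def; apply/polyP=> i; rewrite coef_poly; case: ltnP => // le_ni.
by rewrite nth_default // (leq_trans sf).
Qed.

Lemma recipM a b f g : (size f <= a.+1)%N -> (size g <= b.+1)%N ->
  recip (a + b) (f * g) = recip a f * recip b g.
Proof.
move=> sf sg; rewrite {1}(poly_sum_le sf) {1}(poly_sum_le sg) !recipE -recipE.
rewrite mulr_suml recip_sum mulr_suml; apply: eq_bigr => i _.
rewrite mulr_sumr recip_sum mulr_sumr; apply: eq_bigr => j _.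
rewrite -!scalerAl -!scalerAr -!exprD !recipZ recipXn; last first.
  by rewrite leq_add // -ltnS ltn_ord.
have := ltn_ord i; have := ltn_ord j => lj li.
by congr (_ *: (_ *: 'X^ _)); lia.
Qed.

Lemma recipK n f : (size f <= n.+1)%N -> recip n (recip n f) = f.
Proof.
move=> sf; apply/polyP=> i; rewrite !coef_recip leq_subr.
case: leqP => [le_in | lt_ni]; first by rewrite subKn.
by rewrite nth_default // (leq_trans sf).
Qed.

Lemma recip_eq0 n f : (size f <= n.+1)%N -> (recip n f == 0) = (f == 0).
Proof.
move=> sf; apply/eqP/eqP => [e0|->]; last exact: recip0.
by rewrite -(recipK sf) e0 recip0.
Qed.

Lemma horner_recip n f (x : F) : x != 0 -> (size f <= n.+1)%N ->
  (recip n f).[x^-1] = x ^- n * f.[x].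
Proof.
move=> x0 sf; rewrite recipE {2}(poly_sum_le sf) !horner_sum mulr_sumr.
apply: eq_bigr => i _; rewrite !hornerE /= -mulrA mulrCA; congr (_ * _).
by rewrite exprB ?unitfE ?invr_eq0 ?leq_ord // !exprVn invrK.
Qed.

Lemma size_recip_eq f : f`_0 != 0 -> size (recip (size f).-1 f) = size f.
Proof.
move=> f0; have sf : (0 < size f)%N.
  by rewrite lt0n size_poly_eq0; apply: contraNneq f0 => ->; rewrite coef0.
by rewrite /recip size_poly_eq prednK // subnn.
Qed.

End Reciprocal.

(** * Negacyclic codes *)

Section Codes.
Variables (F : finFieldType) (N : nat).
Hypothesis N_gt0 : (0 < N)%N.
Local Notation W := ('X^N + 1 : {poly F}).
Implicit Types (u v : 'rV[F]_N) (g h : {poly F}) (C : {set 'rV[F]_N}).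

Lemma size_Xn1 : size W = N.+1.
Proof. exact: size_XnaddC. Qed.

Lemma Xn1_neq0 : W != 0.
Proof. by rewrite -size_poly_eq0 size_Xn1. Qed.

Lemma coef_poly_of_row u (i : 'I_N) : (poly_of_row u)`_i = u 0 i.
Proof.
rewrite /poly_of_row coef_sum (bigD1 i) //= coefZ coefXn eqxx mulr1 big1 ?addr0 // => j ji.
by rewrite coefZ coefXn eq_sym (negPf (_ : (j : nat) != i)) ?mulr0.
Qed.

Lemma size_poly_of_row u : (size (poly_of_row u) <= N)%N.
Proof.
apply: (leq_trans (size_sum _ _ _)); apply/bigmax_leqP => i _.
by apply: (leq_trans (size_scale_leq _ _)); rewrite size_polyXn.
Qed.

Lemma size_modW h : (size (h %% W)%R <= N)%N.
Proof. by rewrite -ltnS -size_Xn1 ltn_modp Xn1_neq0. Qed.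

Lemma modW_small h : (size h <= N)%N -> h %% W = h.
Proof. by move=> sh; rewrite modp_small // size_Xn1. Qed.

Lemma row_of_polyK h : poly_of_row (row_of_poly N h) = h %% W.
Proof.
apply/polyP=> i; case: (ltnP i N) => [lt_iN | le_Ni].
  by rewrite (coef_poly_of_row _ (Ordinal lt_iN)) mxE.
by rewrite !nth_default ?(leq_trans _ le_Ni) ?size_poly_of_row ?size_modW.
Qed.

Lemma poly_of_rowK u : row_of_poly N (poly_of_row u) = u.
Proof.
by apply/rowP=> i; rewrite mxE modW_small ?size_poly_of_row // coef_poly_of_row.
Qed.

Lemma poly_of_row_eq0 u : (poly_of_row u == 0) = (u == 0).
Proof.
apply/eqP/eqP => [e0 | ->]; last first.
  by rewrite /poly_of_row big1 // => i _; rewrite mxE scale0r.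
by rewrite -[u]poly_of_rowK e0; apply/rowP=> i; rewrite !mxE mod0p coef0.
Qed.

Lemma row_of_poly_mod h : row_of_poly N (h %% W) = row_of_poly N h.
Proof. by apply/rowP=> i; rewrite !mxE modp_id. Qed.

Lemma row_of_polyD g h : row_of_poly N (g + h) = row_of_poly N g + row_of_poly N h.
Proof. by apply/rowP=> i; rewrite !mxE modpD coefD. Qed.

Lemma negmul_row_of_poly g h :
  negmul (row_of_poly N g) (row_of_poly N h) = row_of_poly N (g * h).
Proof.
rewrite /negmul !row_of_polyK -[LHS]row_of_poly_mod modp_mul mulrC.
by rewrite modp_mul mulrC row_of_poly_mod.
Qed.

Lemma mem_gen_code g v : g %| W -> (v \in gen_code N g) = (g %| poly_of_row v).
Proof.
move=> gW; rewrite inE; apply/existsP/idP => [[a /eqP->] | gv].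
  rewrite -[a]poly_of_rowK negmul_row_of_poly row_of_polyK -dvdp_mod //.
  exact: dvdp_mulr.
exists (row_of_poly N (poly_of_row v %/ g)).
by rewrite negmul_row_of_poly mulrC divpK // poly_of_rowK.
Qed.

Lemma gen_code_eqp g h : g %| W -> h %| W -> gen_code N g = gen_code N h -> g %= h.
Proof.
have dvd g1 g2 : g1 %| W -> g2 %| W -> gen_code N g1 = gen_code N g2 -> g2 %| g1.
  move=> g1W g2W e12; rewrite (dvdp_mod _ g2W) -row_of_polyK -mem_gen_code // -e12.
  by rewrite mem_gen_code // row_of_polyK -dvdp_mod.
by move=> gW hW e; apply/andP; split; apply: dvd.
Qed.

Lemma negacyclicP C : reflect
  [/\ 0 \in C, (forall u v, u \in C -> v \in C -> u + v \in C) &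
      (forall a u, u \in C -> negmul a u \in C)] (negacyclic C).
Proof.
apply: (iffP and3P) => [[C0 CD CM]|[C0 CD CM]]; split=> //.
- by move=> u v uC vC; move/forall_inP: CD => /(_ u uC) /forall_inP; apply.
- by move=> a u uC; move/forallP: CM => /(_ a) /forall_inP; apply.
- by apply/forall_inP=> u uC; apply/forall_inP=> v vC; apply: CD.
- by apply/forallP=> a; apply/forall_inP=> u uC; apply: CM.
Qed.

Lemma gen_code_negacyclic g : g %| W -> negacyclic (gen_code N g).
Proof.
move=> gW; apply/negacyclicP; split.
- by rewrite mem_gen_code // (eqP (_ : poly_of_row 0 == 0)) ?dvdp0 // poly_of_row_eq0.
- move=> u v; rewrite !mem_gen_code // -[u in u + v]poly_of_rowK -[v in _ + v]poly_of_rowK.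
  rewrite -row_of_polyD row_of_polyK -dvdp_mod //; exact: dvdp_add.
- move=> a u; rewrite !mem_gen_code // => gu; rewrite row_of_polyK -dvdp_mod //.
  exact: dvdp_mull.
Qed.

(** The generator is the gcd of all codewords, which lies in the code by Bezout. *)
Lemma negacyclic_principal C : negacyclic C ->
  exists2 g, g \is monic /\ g %| W & C = gen_code N g.
Proof.
move=> /negacyclicP[C0 CD CM].
have QM a f : row_of_poly N f \in C -> row_of_poly N (a * f) \in C.
  by move=> fC; rewrite -negmul_row_of_poly CM.
have Qdvd f1 f2 : f1 %| f2 -> row_of_poly N f1 \in C -> row_of_poly N f2 \in C.
  by move=> f12 f1C; rewrite -(divpK f12) QM.
(* Seeding the gcd with [W] makes it a nonzero divisor of [W] even for the zero code; the row of [W]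
   is 0, so the seed stays in the code. *)
pose G := \big[@gcdp F/W]_(v <- enum C) poly_of_row v.
have GW : G %| W.
  rewrite /G; elim/big_rec: _ => [|v f _ IH]; first exact: dvdpp.
  exact: dvdp_trans (dvdp_gcdr _ _) IH.
have GC : row_of_poly N G \in C.
  rewrite /G big_seq; elim/big_ind: _ => [|f1 f2 f1C f2C|v vC].
  - by rewrite (_ : row_of_poly N W = 0) //; apply/rowP=> i; rewrite !mxE modpp coef0.
  - have [_ /Qdvd d12] := andP (egcdpE f1 f2); apply: d12.
    by rewrite row_of_polyD CD // QM.
  - by rewrite poly_of_rowK -mem_enum.
have Gv v : v \in C -> G %| poly_of_row v.
  move=> vC; rewrite /G.
  have: v \in enum C by rewrite mem_enum.
  elim: (enum C) => // u r IH; rewrite inE big_cons => /predU1P[->|/IH].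
    exact: dvdp_gcdl.
  exact/dvdp_trans/dvdp_gcdr.
have G0 : G != 0 by apply: contraTneq GW => ->; rewrite dvd0p Xn1_neq0.
pose g := (lead_coef G)^-1 *: G.
have gG : g %= G by rewrite eqp_scale // invr_eq0 lead_coef_eq0.
have gW : g %| W by rewrite (eqp_dvdl _ gG).
exists g; first split=> //.
  by rewrite monicE lead_coefZ mulVf // lead_coef_eq0.
apply/setP=> v; rewrite mem_gen_code // (eqp_dvdl _ gG).
apply/idP/idP => [/Gv // | Gdv].
by rewrite -[v]poly_of_rowK (Qdvd _ _ Gdv).
Qed.

(** Reduction subtracts the upper half of [f] from the lower half. The size bound leaves that upper
    half without a coefficient at [N.-1], so an inner product can be read before or after
    reduction. *)
Lemma coef_modW (f : {poly F}) : (size f < N.*2)%N -> (f %% W)`_N.-1 = f`_N.-1.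
Proof.
move=> sf; set f0 := take_poly N f; set f1 := drop_poly N f.
have sf1 : (size f1 < N)%N by rewrite size_drop_poly; lia.
have ef : f = f1 * W + (f0 - f1).
  by rewrite -[LHS](poly_take_drop N) -/f0 -/f1; ring.
have s01 : (size (f0 - f1)%R < size W)%N.
  rewrite size_Xn1 ltnS (leq_trans (size_polyD _ _)) // size_polyN geq_max.
  by rewrite size_take_poly ltnW.
rewrite [in LHS]ef modp_addl_mul_small // coefB coef_take_poly prednK // leqnn.
by rewrite [f1`__]nth_default ?subr0 // -ltnS prednK.
Qed.

Local Notation rev := (recip N.-1).

Lemma inner_productE u v : (v *m u^T) 0 0 = (poly_of_row u * rev (poly_of_row v))`_N.-1.
Proof.
rewrite mxE coefM prednK //; apply: eq_bigr => i _.
have le_iN : (i <= N.-1)%N by rewrite -ltnS prednK.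
by rewrite mxE coef_recip leq_subr subKn // !coef_poly_of_row mulrC.
Qed.

Lemma size_mul_rev u v : (size (poly_of_row u * rev (poly_of_row v))%R < N.*2)%N.
Proof.
apply: leq_ltn_trans (size_polyMleq _ _) _.
have := size_poly_of_row u; have := size_recip N.-1 (poly_of_row v); lia.
Qed.

(** The pairing that takes the coefficient at [N.-1] of a product modulo [W] is nondegenerate, so
    orthogonality to all multiples of [g] means that [W] divides [g * rev v]. *)
Lemma mem_dual_gen_code g h v : g * h = W ->
  (v \in dual_code (gen_code N g)) = (h %| rev (poly_of_row v)).
Proof.
move=> eW; have gW : g %| W by rewrite -eW dvdp_mulr.
have g0 : g != 0 by apply: contraTneq gW => ->; rewrite dvd0p Xn1_neq0.
rewrite inE; apply/forall_inP/idP => [vC | hv c cC]; last first.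
  rewrite inner_productE -coef_modW ?size_mul_rev //.
  have : W %| poly_of_row c * rev (poly_of_row v).
    by rewrite -eW dvdp_mul // -mem_gen_code.
  by move/modp_eq0P=> ->; rewrite coef0.
have phi0 a : ((a * (g * rev (poly_of_row v))) %% W)`_N.-1 = 0.
  have := vC (row_of_poly N (a * g)).
  rewrite mem_gen_code // row_of_polyK -dvdp_mod // dvdp_mull // => /(_ isT) /eqP.
  rewrite inner_productE -coef_modW ?size_mul_rev // row_of_polyK.
  by rewrite mulrC modp_mul mulrC mulrA.
set w := (g * _) in phi0.
have w0 : w %% W = 0.
  apply/eqP/negPn/negP => wn0.
  have sw := size_modW w; have sw0 : (0 < size (w %% W)%R)%N by rewrite lt0n size_poly_eq0.
  (* This shift moves the leading coefficient of [w %% W] to position [N.-1] without wrapping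
     around. *)
  have := phi0 'X^(N - size (w %% W)%R); rewrite -modp_mul.
  rewrite [('X^_ * _) %% _]modW_small; last by rewrite mulrC size_mulXn // subnK.
  rewrite coefXnM ifF; last by lia.
  rewrite (_ : (_ - _)%N = (size (w %% W)%R).-1); last by lia.
  by move/eqP; rewrite -lead_coefE lead_coef_eq0 (negPf wn0).
have : W %| w by apply/modp_eq0P.
by rewrite -eW dvdp_mul2l.
Qed.

Lemma recip_Xn1 : recip N W = W.
Proof. by rewrite recipD recipXn // -(expr0 'X) recipXn // subnn subn0 addrC. Qed.

(** Write g* and h* for the reciprocals. LCD says that no nonzero [f] of size at most [N] has
    [g %| f] and [h %| rev f], which forces [g] to be coprime to h*. Since [g h] and g* h* both
    equal [W], h* is then associated to [h], and g* to [g]. *)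
Lemma LCD_gen_code g h : g * h = W ->
  LCD (gen_code N g) = coprimep g h && (recip (size g).-1 g %= g).
Proof.
move=> eW; have gW : g %| W by rewrite -eW dvdp_mulr.
have /norP[g0 h0] : ~~ ((g == 0) || (h == 0)) by rewrite -mulf_eq0 eW Xn1_neq0.
have sg : (0 < size g)%N by rewrite lt0n size_poly_eq0.
have sh : (0 < size h)%N by rewrite lt0n size_poly_eq0.
have sgh : (size g + size h).-1 = N.+1 by rewrite -size_mul // eW size_Xn1.
have /norP[g00 h00] : ~~ ((g`_0 == 0) || (h`_0 == 0)).
  rewrite -mulf_eq0 -coef0M eW coefD coefXn coef1 eqxx.
  by rewrite (ltn_eqF N_gt0) add0r oner_neq0.
pose a := (size g).-1; pose b := (size h).-1.
have ab : (a + b)%N = N by rewrite /a /b; lia.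
have sga : size g = a.+1 by rewrite prednK.
have shb : size h = b.+1 by rewrite prednK.
have eWs : recip a g * recip b h = W.
  by rewrite -recipM ?sga ?shb // ab eW recip_Xn1.
have sgs : size (recip a g) = size g := size_recip_eq g00.
have shs : size (recip b h) = size h := size_recip_eq h00.
rewrite -/a; apply/eqP/andP => [lcd | [cgh gs]].
  have inj0 (f : {poly F}) : (size f <= N)%N -> g %| f -> h %| rev f -> f = 0.
    move=> sf gf hf; have pf : poly_of_row (row_of_poly N f) = f.
      by rewrite row_of_polyK modW_small.
    have: row_of_poly N f \in gen_code N g :&: dual_code (gen_code N g).
      by rewrite in_setI mem_gen_code // (mem_dual_gen_code _ eW) pf gf hf.
    by rewrite lcd inE -poly_of_row_eq0 pf => /eqP.
  have hs0 : recip b h != 0 by rewrite -size_poly_eq0 shs size_poly_eq0.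
  (* If the gcd [k] were nonconstant, the common multiple (g/k) h* = g (h*/k) would have degree
     below [N] and lie in the code and in its dual. *)
  have cghs : coprimep g (recip b h).
    rewrite /coprimep; set k := gcdp _ _; apply/negPn/negP => sk1.
    have kg : k %| g := dvdp_gcdl _ _.
    have kh : k %| recip b h := dvdp_gcdr _ _.
    have k0 : k != 0 by rewrite gcdp_eq0 negb_and g0.
    have sk : (1 < size k)%N by move: k0 sk1; rewrite -size_poly_eq0; lia.
    have c0 : g %/ k != 0 by rewrite dvdp_div_eq0.
    have sc : (size (g %/ k)%R <= a.-1.+1)%N.
      have := dvdp_leq g0 kg; rewrite size_divp // sga; move: sk; clearbody a; clear; lia.
    have a0 : (0 < a)%N by have := dvdp_leq g0 kg; rewrite sga; move: sk; clearbody a; clear; lia.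
    have ev : g * (recip b h %/ k) = (g %/ k) * recip b h.
      by rewrite -[g in LHS](divpK kg) -mulrA [k * _]mulrC divpK.
    have : (g %/ k) * recip b h = 0; last first.
      by apply/eqP; rewrite mulf_neq0.
    apply: inj0.
    - by rewrite (leq_trans (size_polyMleq _ _)) // shs shb -ab -[a](prednK a0) addnS leq_add2r.
    - by rewrite -ev dvdp_mulr.
    - rewrite (_ : N.-1 = (a.-1 + b)%N); last by lia.
      by rewrite recipM ?shs ?shb // recipK ?shb // dvdp_mull.
  (* h* divides [W = g h] and is coprime to [g], hence divides [h]; the sizes agree. *)
  have hsh : recip b h %= h.
    rewrite -dvdp_size_eqp ?shs // -(Gauss_dvdpr _ (_ : coprimep _ g)); last first.
      by rewrite coprimep_sym.
    by rewrite eW -eWs dvdp_mull.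
  rewrite -(eqp_coprimepr _ hsh); split=> //.
  rewrite -(eqp_mul2r _ _ hs0) eWs -eW eqp_mul2l //.
  by rewrite eqp_sym.
apply/setP=> v; rewrite in_setI in_set1 mem_gen_code // (mem_dual_gen_code _ eW).
rewrite -poly_of_row_eq0; have := size_poly_of_row v; set f := poly_of_row v => sf.
apply/idP/eqP => [/andP[gf hf] | ->]; last by rewrite recip0 !dvdp0.
apply/eqP; apply: contraT => f0.
have sg_f := dvdp_leq f0 gf.
have le_aN : (a <= N.-1)%N by rewrite -ltnS prednK // -sga (leq_trans sg_f).
(* Reversing [f = (f/g) g] yields a multiple of g*, hence of [g]. With [h %| rev f] and coprimality,
   [W] divides a polynomial of smaller degree. *)
have g_rf : g %| rev f.
  rewrite -(divpK gf) -(subnK le_aN) recipM ?sga //.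
    by rewrite dvdp_mull // (eqp_dvdr _ gs).
  by rewrite size_divp // -subSn // prednK // leq_sub2r.
have : W %| rev f by rewrite -eW Gauss_dvdp // g_rf.
have [/eqP | rf0] := eqVneq (rev f) 0; first by rewrite recip_eq0 ?prednK // (negPf f0).
move/(dvdp_leq rf0); rewrite size_Xn1 => /leq_trans/(_ (size_recip _ _)).
by rewrite prednK // ltnn.
Qed.

End Codes.

(** * LCD codes and orbits of roots *)

Section SplitPolynomials.
Variable L : fieldType.
Implicit Types (r : seq L) (f : {poly L}).

Lemma coprimep_prod_XsubC_l r f :
  coprimep (\prod_(x <- r) ('X - x%:P)) f = all (fun x => ~~ root f x) r.
Proof.
elim: r => [|x r IH] /=; first by rewrite big_nil coprime1p.
by rewrite big_cons coprimepMl IH coprimep_sym coprimep_XsubC.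
Qed.

Lemma recipX a f j : (size f <= a.+1)%N -> recip (a * j) (f ^+ j) = recip a f ^+ j.
Proof.
move=> sf; elim: j => [|j IH].
  by rewrite muln0 !expr0; apply/polyP=> -[|i]; rewrite coef_recip !coef1.
rewrite mulnS !exprS recipM // ?IH //.
have := size_poly_exp_leq f j.
move/leq_trans; apply; rewrite ltnS leq_mul2r; apply/orP; right.
by move: sf; case: (size f).
Qed.

Lemma recip_prod_XsubC r : (forall x, x \in r -> x != 0) ->
  recip (size r) (\prod_(x <- r) ('X - x%:P)) %= \prod_(x <- r) ('X - (x^-1)%:P).
Proof.
elim: r => [|x r IH] r0.
  rewrite !big_nil; apply/eqpW.
  by apply/polyP=> -[|i]; rewrite coef_recip !coef1.
have x0 : x != 0 by rewrite r0 ?mem_head.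
rewrite !big_cons /= -add1n recipM ?size_XsubC ?size_prod_XsubC //.
apply: eqp_trans (eqp_mull _ (IH _)) _.
  by move=> y yr; rewrite r0 // inE yr orbT.
(* The reciprocal of X - x is 1 - x X, that is, -x times X - x^-1. *)
apply: eqp_mulr; apply/eqpf_eq; exists (- x); first by rewrite oppr_eq0.
apply/polyP=> -[|[|i]]; rewrite coef_recip !(coefZ, coefB, coefX, coefC) /=; try by ring.
by rewrite sub0r mulrN mulNr opprK mulfV ?subr0.
Qed.

Lemma map_recip (F : fieldType) (h : {rmorphism F -> L}) n (g : {poly F}) :
  map_poly h (recip n g) = recip n (map_poly h g).
Proof.
apply/polyP=> i; rewrite coef_map /= !coef_recip.
by case: ifP; rewrite ?rmorph0 // coef_map.
Qed.

End SplitPolynomials.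

(** * Descent of polynomials from [L] to [F] by invariance under the [q]-power map *)

Section Frobenius.
Variables (L : fieldType) (p s : nat).
Hypothesis chL : p \in [pchar L].
Local Notation q := (p ^ s)%N.

Lemma frobD (x y : L) : (x + y) ^+ q = x ^+ q + y ^+ q.
Proof.
apply: exprDn_pchar; rewrite pnatX; apply/orP; left.
by rewrite pnatE ?(pcharf_prime chL) // pchar_of_pchar.
Qed.

Lemma frobB (x y : L) : (x - y) ^+ q = x ^+ q - y ^+ q.
Proof. by apply/eqP; rewrite eq_sym subr_eq -frobD subrK. Qed.

Lemma frob_inj : injective (fun x : L => x ^+ q).
Proof.
move=> x y /= /eqP; rewrite -subr_eq0 -frobB expf_eq0 subr_eq0.
by case/andP=> _ /eqP.
Qed.

Lemma coef_prod_XsubC_frob (r : seq L) i :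
  (\prod_(x <- r) ('X - (x ^+ q)%:P))`_i = (\prod_(x <- r) ('X - x%:P))`_i ^+ q.
Proof.
have q0 : (0 < q)%N by rewrite expn_gt0 prime_gt0 ?(pcharf_prime chL).
have z0 : (0 : L) ^+ q = 0 by rewrite expr0n gtn_eqF.
elim: r i => [|x r IH] i; first by rewrite !big_nil coef1; case: eqP; rewrite ?z0 ?expr1n.
rewrite !big_cons !mulrBl !coefB !coefXM !coefCM frobB exprMn !IH.
by case: eqP; rewrite ?z0.
Qed.

(** The [q]-power map is injective, so it permutes a finite set that it maps into itself. *)
Lemma prod_XsubC_frob_stable (r : seq L) : uniq r ->
  (forall x, x \in r -> x ^+ q \in r) ->
  forall i, (\prod_(x <- r) ('X - x%:P))`_i ^+ q = (\prod_(x <- r) ('X - x%:P))`_i.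
Proof.
move=> ru rq i; rewrite -coef_prod_XsubC_frob.
rewrite -(big_map (fun x => x ^+ q) predT (fun x => 'X - x%:P)).
rewrite (perm_big r) //; apply: uniq_perm => //; first by rewrite map_inj_uniq //; exact: frob_inj.
have sub : {subset [seq x ^+ q | x <- r] <= r} by move=> _ /mapP[x xr ->]; exact: rq.
have [] // := uniq_min_size _ sub _; first by rewrite map_inj_uniq //; exact: frob_inj.
by rewrite size_map.
Qed.

Variables (F : finFieldType) (h : {rmorphism F -> L}).
Hypothesis cardF : #|F| = q.

(** X^q - X already splits over [F], with the elements of [F] as its roots. *)
Lemma frob_fixed (y : L) : y ^+ q = y -> exists a : F, h a = y.
Proof.
move=> yq; have : root (map_poly h ('X^#|F| - 'X)) y.
  by rewrite rmorphB /= map_polyXn map_polyX rootE !hornerE cardF yq subrr.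
rewrite finField_genPoly rmorph_prod /= rootE horner_prod => /prodf_eq0[a _].
by rewrite rmorphB /= map_polyX map_polyC !hornerE subr_eq0 => /eqP->; exists a.
Qed.

Lemma root_map_frob (g : {poly F}) (x : L) :
  root (map_poly h g) x -> root (map_poly h g) (x ^+ q).
Proof.
have q0 : (0 < q)%N by rewrite expn_gt0 prime_gt0 ?(pcharf_prime chL).
have z0 : (0 : L) ^+ q = 0 by rewrite expr0n gtn_eqF.
suff e : (map_poly h g).[x ^+ q] = (map_poly h g).[x] ^+ q.
  by rewrite !rootE e => /eqP->; rewrite z0.
rewrite !horner_coef (big_morph (fun z : L => z ^+ q) frobD z0).
apply: eq_bigr => i _; rewrite exprMn -!exprM mulnC; congr (_ * _).
by rewrite coef_map -rmorphXn -cardF expf_card.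
Qed.

Lemma root_map_frob_iter (g : {poly F}) (x : L) i :
  root (map_poly h g) x -> root (map_poly h g) (x ^+ (q ^ i)).
Proof.
move=> gx; elim: i => [|i IH]; first by rewrite expr1.
by rewrite expnSr exprM root_map_frob.
Qed.

(* A coefficient outside the image of [h] is replaced by [0]. *)
Definition descend (f : {poly L}) : {poly F} :=
  \poly_(i < size f) odflt 0 [pick a | h a == f`_i].

Lemma descendP (f : {poly L}) : (forall i, f`_i ^+ q = f`_i) ->
  map_poly h (descend f) = f.
Proof.
move=> fq; apply/polyP=> i; rewrite coef_map coef_poly /=.
case: ltnP => [_ | sf]; last by rewrite rmorph0 nth_default.
case: pickP => [a /eqP // | no]; have [a ha] := frob_fixed (fq i).
by have := no a; rewrite ha eqxx.
Qed.

Lemma descend_map (g : {poly F}) : map_poly h (descend (map_poly h g)) = map_poly h g.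
Proof.
apply: descendP => i.
by rewrite coef_map -rmorphXn -cardF expf_card.
Qed.

End Frobenius.

(** Only nonnegative powers of the [q]-power map occur. Symmetry is therefore a separate fact,
    proved for roots of X^d + 1, on which that map has finite order. *)
Definition qorbit (L : fieldType) (q : nat) (x y : L) : Prop :=
  exists i, y = x ^+ (q ^ i) \/ y = (x ^+ (q ^ i))^-1.

Section Orbits.
Variables (L : fieldType) (q d : nat).
Hypotheses (d_gt0 : (0 < d)%N) (coqd : coprime q d.*2).
Implicit Types x y : L.

Lemma root_neg1_neq0 x : x ^+ d = -1 -> x != 0.
Proof.
move=> xd; apply/eqP => x0; move/eqP: xd.
by rewrite x0 expr0n gtn_eqF // eq_sym oppr_eq0 oner_eq0.
Qed.

Lemma qorbit_refl x : qorbit q x x.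
Proof. by exists 0%N; left. Qed.

Lemma qorbit_trans x y z : qorbit q x y -> qorbit q y z -> qorbit q x z.
Proof.
move=> [i ei] [j ej]; exists (i + j)%N; rewrite expnD exprM.
by case: ei ej => -> [] ->; rewrite ?exprVn ?invrK; [left | right | right | left].
Qed.

Lemma qorbit_inv x y : qorbit q x y -> qorbit q x y^-1.
Proof. by move=> [i [] ->]; exists i; [right | left]; rewrite ?invrK. Qed.

Lemma qorbit_sym x y : x ^+ d = -1 -> qorbit q x y -> qorbit q y x.
Proof.
move=> xd; have x2d : x ^+ d.*2 = 1 by rewrite -muln2 exprM xd sqrrN expr1n.
(* Roots of X^d + 1 have order dividing 2d, so the exponent [q ^ T] acts trivially on them, and
   [q ^ (T.-1 * i)] undoes [q ^ i]. *)
pose T := totient d.*2; have T0 : (0 < T)%N by rewrite totient_gt0 double_gt0.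
have xT i : x ^+ (q ^ (T * i)) = x.
  rewrite expnM; elim: i => [|i IH]; first by rewrite expr1.
  rewrite expnSr exprM IH -(expr_mod _ x2d) (Euler_exp_totient coqd).
  by rewrite modn_small ?expr1 // -addnn; lia.
move=> [i ei]; have e : x ^+ (q ^ i) ^+ (q ^ (T.-1 * i)) = x.
  by rewrite -exprM -expnD -{1}[i]mul1n -mulnDl add1n prednK.
exists (T.-1 * i)%N; case: ei => ->; [left | right].
  by rewrite e.
by rewrite exprVn invrK e.
Qed.

Lemma qorbit_root x y : odd q -> x ^+ d = -1 -> qorbit q x y -> y ^+ d = -1.
Proof.
move=> oq xd [i ei]; have e : (x ^+ (q ^ i)) ^+ d = -1.
  by rewrite exprAC xd -signr_odd oddX oq orbT expr1.
by case: ei => ->; rewrite ?exprVn e ?invrN1.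
Qed.

End Orbits.

(** * LCD codes as selections of orbits, for an arbitrary indexing of the orbits *)

Section OrbitCodes.
Variables (F : finFieldType) (L : fieldType) (h : {rmorphism F -> L}).
Variables (p s n d : nat).
Local Notation q := (p ^ s)%N.
Local Notation pn := (p ^ n)%N.
Local Notation N := (d * pn)%N.
Hypotheses (p_prime : prime p) (cardF : #|F| = q) (odd_q : odd q).
Hypotheses (d_gt0 : (0 < d)%N) (coqd : coprime q d.*2).
(** [Om] certifies that X^d + 1 splits over [L] with [d] distinct roots. *)
Variable Om : seq L.
Hypotheses (uniq_Om : uniq Om) (size_Om : size Om = d).
Hypothesis root_Om : forall x, x \in Om -> x ^+ d = -1.
Variables (K : choiceType) (idx : seq K) (b : K -> L) (B : K -> seq L).
Hypothesis uniq_idx : uniq idx.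
Hypothesis uniq_B : forall k, k \in idx -> uniq (B k).
Hypothesis mem_B : forall k, k \in idx -> forall y, y \in B k <-> qorbit q (b k) y.
Hypothesis root_b : forall k, k \in idx -> b k ^+ d = -1.
Hypothesis b_distinct : forall k k', k \in idx -> k' \in idx ->
  qorbit q (b k) (b k') -> k = k'.
Hypothesis b_cover : forall x : L, x ^+ d = -1 -> exists2 k, k \in idx & qorbit q (b k) x.

Implicit Types (S : pred K) (x y : L) (k : K).

Let chL : p \in [pchar L].
Proof. by rewrite (fmorph_pchar h) (card_finPcharP cardF). Qed.

Let pn_gt0 : (0 < pn)%N. Proof. by rewrite expn_gt0 prime_gt0. Qed.

Let N_gt0 : (0 < N)%N. Proof. by rewrite muln_gt0 d_gt0. Qed.

Definition block (k : K) : {poly L} := \prod_(x <- B k) ('X - x%:P).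

Definition blocks (S : pred K) : {poly L} := \prod_(k <- idx | S k) block k.

Let zeros (S : pred K) : seq L := flatten [seq B k | k <- idx & S k].

Let blocksE S : blocks S = \prod_(x <- zeros S) ('X - x%:P).
Proof. by rewrite /zeros big_flatten big_map big_filter. Qed.

Let mem_zeros S x : reflect (exists2 k, k \in idx /\ S k & x \in B k) (x \in zeros S).
Proof.
apply: (iffP flattenP) => [[r /mapP[k]] | [k [ki Sk] xB]].
  by rewrite mem_filter => /andP[Sk ki] -> xB; exists k.
by exists (B k) => //; apply: map_f; rewrite mem_filter Sk.
Qed.

Let root_B k x : k \in idx -> x \in B k -> x ^+ d = -1.
Proof. by move=> ki /(mem_B ki); apply: qorbit_root => //; apply: root_b. Qed.

Let b_B k : k \in idx -> b k \in B k.
Proof. by move=> ki; apply/mem_B => //; apply: qorbit_refl. Qed.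

Let B_disjoint k k' x : k \in idx -> k' \in idx -> x \in B k -> x \in B k' -> k = k'.
Proof.
move=> ki k'i /(mem_B ki) kx /(mem_B k'i) k'x; apply: b_distinct => //.
exact: qorbit_trans kx (qorbit_sym d_gt0 coqd (root_b k'i) k'x).
Qed.

Let root_zeros S x : x \in zeros S -> x ^+ d = -1.
Proof. by case/mem_zeros=> k [ki _]; apply: root_B. Qed.

Let zeros_frob S x : x \in zeros S -> x ^+ q \in zeros S.
Proof.
case/mem_zeros=> k [ki Sk] /(mem_B ki) xB; apply/mem_zeros; exists k => //.
apply/(mem_B ki); apply: qorbit_trans xB _.
by exists 1%N; left; rewrite expn1.
Qed.

Let zeros_inv S x : x \in zeros S -> x^-1 \in zeros S.
Proof.
case/mem_zeros=> k [ki Sk] /(mem_B ki) xB; apply/mem_zeros; exists k => //.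
exact/(mem_B ki)/qorbit_inv.
Qed.

Let uniq_zeros S : uniq (zeros S).
Proof.
rewrite /zeros; have := filter_uniq S uniq_idx.
have : {subset filter S idx <= idx} by move=> k; rewrite mem_filter => /andP[].
elim: (filter S idx) => //= k r IH sub /andP[kr ur].
have ki : k \in idx by rewrite sub ?mem_head.
have sub' : {subset r <= idx} by move=> k' k'r; rewrite sub // inE k'r orbT.
rewrite cat_uniq uniq_B // IH // andbT; apply/hasPn => x /flattenP[_ /mapP[k' k'r ->] xk'].
apply/negP=> /= xk; move: kr.
by rewrite (B_disjoint ki (sub' _ k'r) xk xk') k'r.
Qed.

(** The orbits cover [Om], and X^d + 1 has at most [d] roots, so all zeros together are a
    permutation of [Om]. *)
Let blocks_all : blocks predT = 'X^d + 1.
Proof.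
have sXd : size ('X^d + 1 : {poly L}) = d.+1 by rewrite size_XnaddC.
have lcX : lead_coef ('X^d + 1 : {poly L}) = 1 by rewrite lead_coefXnaddC.
have -> : 'X^d + 1 = \prod_(x <- Om) ('X - x%:P) :> {poly L}.
  rewrite [LHS](@all_roots_prod_XsubC _ _ Om) ?size_Om ?lcX ?scale1r ?uniq_rootsE //.
  by apply/allP=> x /root_Om xd; rewrite rootE !hornerE xd addNr.
rewrite blocksE; apply: perm_big.
apply: uniq_perm => //.
have sub : {subset Om <= zeros predT}.
  move=> x /root_Om/b_cover[k ki kx]; apply/mem_zeros; exists k => //; exact/mem_B.
have [] // := uniq_min_size uniq_Om sub _ => [|_ e].
  rewrite size_Om -ltnS -sXd max_poly_roots // -?size_poly_eq0 ?sXd //.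
  by apply/allP=> x /root_zeros xd; rewrite rootE !hornerE xd addNr.
by move=> x; rewrite e.
Qed.

Let blocksC S : blocks S * blocks (predC S) = 'X^d + 1.
Proof. by rewrite -blocks_all /blocks [in RHS](bigID S). Qed.

Let blocks_pnC S : blocks S ^+ pn * blocks (predC S) ^+ pn = 'X^N + 1.
Proof.
rewrite -exprMn blocksC exprDn_pchar ?expr1n ?exprM //.
rewrite (eq_pnat _ (_ : _ =i [pchar L])) => [|x]; last exact: pchar_poly.
rewrite pnatX; apply/orP; left.
by rewrite pnatE // pchar_of_pchar.
Qed.

Let coprime_blocksC S : coprimep (blocks S) (blocks (predC S)).
Proof.
rewrite [blocks S]blocksE coprimep_prod_XsubC_l; apply/allP=> x xS.
rewrite blocksE root_prod_XsubC; apply/negP=> /mem_zeros[k [ki /= nSk] xk].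
by case/mem_zeros: xS => k' [k'i Sk'] xk'; rewrite (B_disjoint ki k'i xk xk') Sk' in nSk.
Qed.

Let descend_blocks S : map_poly h (descend h (blocks S ^+ pn)) = blocks S ^+ pn.
Proof.
have e : map_poly h (descend h (blocks S)) = blocks S.
  have := @descendP L p s F h cardF (blocks S); apply=> i.
  rewrite blocksE (prod_XsubC_frob_stable chL) //.
  exact: zeros_frob.
by rewrite -e -rmorphXn (descend_map _ cardF).
Qed.

Let map_Xn1 j : map_poly h ('X^j + 1) = 'X^j + 1.
Proof. by rewrite rmorphD /= map_polyXn rmorph1. Qed.

Lemma gen_blocks_LCD S g : map_poly h g = blocks S ^+ pn -> LCD_negacyclic (gen_code N g).
Proof.
move=> eg; pose g' := descend h (blocks (predC S) ^+ pn).
have eg' : map_poly h g' = blocks (predC S) ^+ pn by apply: descend_blocks.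
have eW : g * g' = 'X^N + 1.
  by apply: (map_poly_inj h); rewrite rmorphM /= eg eg' map_Xn1 blocks_pnC.
apply/andP; split; first by rewrite gen_code_negacyclic -?eW ?dvdp_mulr.
rewrite (LCD_gen_code _ eW) //; apply/andP; split.
  by rewrite -(coprimep_map h) eg eg' coprimep_expl // coprimep_expr.
rewrite -(eqp_map h) map_recip eg.
have -> : (size g).-1 = (size (zeros S) * pn)%N.
  by rewrite -(size_map_poly h) eg blocksE size_exp size_prod_XsubC.
rewrite recipX blocksE ?size_prod_XsubC //; apply: eqp_exp.
apply: eqp_trans (recip_prod_XsubC _) _.
  by move=> x /root_zeros; apply: root_neg1_neq0.
apply/eqpW; rewrite -(big_map (fun x => x^-1) predT (fun x => 'X - x%:P)).
apply: perm_big; apply: uniq_perm; rewrite ?map_inj_uniq //; try exact: invr_inj.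
have sub : {subset [seq x^-1 | x <- zeros S] <= zeros S}.
  by move=> _ /mapP[x xr ->]; exact: zeros_inv.
have [] // := uniq_min_size _ sub _; last by rewrite size_map.
by rewrite map_inj_uniq //; exact: invr_inj.
Qed.

(** The roots of [f] are closed under the [q]-power map (coefficients in [F]) and under inversion
    (self-reciprocity). Since [f] and [f'] are coprime, each orbit belongs entirely to one of
    them. *)
Lemma LCD_gen_blocks C : LCD_negacyclic C ->
  exists S g, map_poly h g = blocks S ^+ pn /\ C = gen_code N g.
Proof.
case/andP=> /(negacyclic_principal N_gt0)[g [gm gW] ->] lcd.
have [g' eW] : exists g', g * g' = 'X^N + 1.
  by exists (('X^N + 1) %/ g); rewrite divpKC.
move: lcd; rewrite (LCD_gen_code _ eW) // => /andP[cop grec].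
set f := map_poly h g; set f' := map_poly h g'.
have ef : f * f' = 'X^N + 1 by rewrite -rmorphM eW; exact: map_Xn1.
have copf : coprimep f f' by rewrite coprimep_map.
have root_orb x y : x ^+ d = -1 -> qorbit q x y -> root f x -> root f y.
  move=> xd [i ei] /(root_map_frob_iter chL cardF i) rf.
  case: ei => -> //.
  have x0 : x ^+ (q ^ i) != 0 by rewrite expf_neq0 // (root_neg1_neq0 d_gt0).
  have : f %= recip (size f).-1 f.
    by rewrite /f size_map_poly -map_recip eqp_map eqp_sym.
  move/eqp_root=> ->; rewrite rootE horner_recip ?leqSpred //.
  by rewrite (eqP rf) mulr0.
pose S k := root f (b k); exists S, g; split=> //; rewrite -/f.
have root_f k x : k \in idx -> x \in B k -> root f x = S k.
  move=> ki /(mem_B ki) kx; apply/idP/idP; last by apply: root_orb kx; apply: root_b.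
  apply: root_orb (qorbit_sym d_gt0 coqd (root_b ki) kx).
  by apply: qorbit_root kx => //; apply: root_b.
have root_f' k x : k \in idx -> x \in B k -> root f' x = ~~ S k.
  move=> ki xB; have : root (f * f') x.
    rewrite ef -(blocks_pnC S) -exprMn blocksC rootE horner_exp !hornerE (root_B ki xB).
    by rewrite addNr expr0n gtn_eqF.
  rewrite rootM -(root_f _ _ ki xB); case: (boolP (root f x)) => //= fx _.
  by apply/negbTE; rewrite rootE (coprimep_root copf fx).
(* [blocks S ^+ pn] divides [f * f'] and has no root in common with [f'], so it divides [f]; the
   complement is handled symmetrically. *)
have dvd1 : blocks S ^+ pn %| f.
  rewrite -(@Gauss_dvdpl _ _ f') ?ef -?(blocks_pnC S) ?dvdp_mulr //.
  rewrite coprimep_expl // blocksE coprimep_prod_XsubC_l; apply/allP=> x.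
  by case/mem_zeros=> k [ki Sk] xk; rewrite (root_f' _ _ ki xk) Sk.
have dvd2 : blocks (predC S) ^+ pn %| f'.
  rewrite -(@Gauss_dvdpr _ _ f) ?ef -?(blocks_pnC S) ?dvdp_mull //.
  rewrite coprimep_expl // blocksE coprimep_prod_XsubC_l; apply/allP=> x.
  by case/mem_zeros=> k [ki Sk] xk; rewrite (root_f _ _ ki xk).
apply/eqP; rewrite -eqp_monic //; last first.
- by rewrite blocksE monic_exp // monic_prod_XsubC.
- by rewrite map_monic.
rewrite /eqp dvd1 andbT.
have Q0 : blocks (predC S) ^+ pn != 0.
  by rewrite expf_neq0 // blocksE monic_neq0 // monic_prod_XsubC.
(* Both factorizations have the same product, so divisibility of [f'] by the complementary factor
   gives the converse divisibility for [f]. *)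
rewrite -(dvdp_mul2r _ _ Q0) blocks_pnC -ef dvdp_mul //.
Qed.

Let prod_block_eps (eps : K -> nat) : (forall k, eps k \in [:: 0%N; pn]) ->
  \prod_(k <- idx) block k ^+ eps k = blocks (fun k => eps k != 0%N) ^+ pn.
Proof.
move=> epsP; rewrite /blocks -prodrXl [RHS]big_mkcond /=; apply: eq_bigr => k _.
by have := epsP k; rewrite !inE => /orP[] /eqP->; rewrite ?expr0 // -lt0n pn_gt0.
Qed.

Lemma LCD_negacyclicP C : LCD_negacyclic C <->
  exists g : {poly F},
    (exists eps : K -> nat, (forall k, eps k \in [:: 0%N; pn]) /\
       map_poly h g = \prod_(k <- idx) block k ^+ eps k) /\ C = gen_code N g.
Proof.
split=> [/LCD_gen_blocks[S [g [eg ->]]] | [g [[eps [epsP eg]] ->]]].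
  exists g; split=> //; exists (fun k => if S k then pn else 0%N).
  have epsP k : (if S k then pn else 0%N) \in [:: 0%N; pn].
    by rewrite !inE; case: ifP; rewrite eqxx ?orbT.
  split=> //; rewrite prod_block_eps // eg; congr (_ ^+ _).
  by apply: eq_bigl => k; case: (S k); rewrite // -lt0n pn_gt0.
by apply: gen_blocks_LCD; rewrite eg prod_block_eps.
Qed.

Let root_blocks_b S k : k \in idx -> root (blocks S ^+ pn) (b k) = S k.
Proof.
move=> ki; rewrite rootE horner_exp expf_eq0 pn_gt0 -rootE blocksE root_prod_XsubC.
apply/mem_zeros/idP => [[k' [k'i Sk'] kB] | Sk]; last by exists k => //; exact: b_B.
by rewrite (B_disjoint ki k'i (b_B ki) kB).
Qed.

Lemma card_LCD_negacyclic :
  #|[set C : {set 'rV[F]_N} | LCD_negacyclic C]| = (2 ^ size idx)%N.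
Proof.
(* Selections are counted as Boolean functions on the elements of [idx]; [blocks] never looks at the
   default value outside [idx]. *)
pose sel (f : {ffun seq_sub idx -> bool}) k :=
  if (insub k : option (seq_sub idx)) is Some u then f u else false.
pose code f := gen_code N (descend h (blocks (sel f) ^+ pn)).
have dvdW f : descend h (blocks (sel f) ^+ pn) %| 'X^N + 1.
  by rewrite -(dvdp_map h) descend_blocks map_Xn1 -(blocks_pnC (sel f)) dvdp_mulr.
have code_inj : injective code.
  move=> f1 f2 /(gen_code_eqp N_gt0 (dvdW f1) (dvdW f2)).
  rewrite -(eqp_map h) !descend_blocks => /eqp_root e; apply/ffunP=> u.
  (* The selection is recovered from the code by testing whether each representative is a root of
     the generator. *)
  by have := e (b (val u)); rewrite !root_blocks_b ?(valP u) // /sel !valK.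
transitivity #|[set code f | f : {ffun seq_sub idx -> bool}]|; last first.
  by rewrite card_imset // card_ffun card_bool card_seq_sub.
apply: eq_card => C; rewrite inE; apply/idP/imsetP => [|[f _ ->]]; last first.
  exact: gen_blocks_LCD (descend_blocks (sel f)).
case/LCD_gen_blocks=> S [g [eg ->]].
pose f := [ffun u : seq_sub idx => S (val u)]; exists f => //; congr gen_code.
apply: (map_poly_inj h); rewrite descend_blocks eg; congr (_ ^+ _).
rewrite /blocks [LHS]big_seq_cond [RHS]big_seq_cond; apply: eq_bigl => k.
by case ki: (k \in idx) => //=; rewrite /sel (insubT (fun k => k \in idx) ki) ffunE.
Qed.

End OrbitCodes.

(** * Congruences modulo prime powers *)

Local Open Scope nat_scope.

(** The bound [T <= k] justifies the finite searches in [ordn] and [cyc], which try only [k]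
    consecutive exponents. *)
Lemma coprime_exp_period a k : coprime a k -> 0 < k ->
  exists2 T, 0 < T <= k & forall i, a ^ (T * i) = 1 %[mod k].
Proof.
move=> co k0; exists (totient k).
  rewrite totient_gt0 k0 /= totient_count_coprime.
  rewrite big_mkord; apply: (@leq_trans (\sum_(i < k) 1)); last by rewrite sum1_card card_ord.
  by apply: leq_sum => i _; apply: leq_b1.
by move=> i; rewrite expnM -modnXm Euler_exp_totient // modnXm exp1n.
Qed.

Lemma coprime_prime_gt0 a l : prime l -> coprime a l -> 0 < a.
Proof. by case: a => // pr_l; rewrite /coprime gcd0n gtn_eqF // prime_gt1. Qed.

Section MultiplicativeOrder.
Variables (k a : nat).
Hypotheses (k_gt1 : 1 < k) (coak : coprime a k).

Let Q i := a ^ i.+1 %% k == 1 %% k.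

Let hasQ : has Q (iota 0 k).
Proof.
have [T /andP[T0 Tk] aT] := coprime_exp_period coak (ltnW k_gt1).
apply/hasP; exists T.-1; first by rewrite mem_iota /= add0n prednK.
by rewrite /Q prednK // -{1}[T]muln1 aT.
Qed.

Lemma ordnP : a ^ ordn k a = 1 %[mod k].
Proof.
have := nth_find 0 hasQ; rewrite nth_iota; last by move: hasQ; rewrite has_find size_iota.
by move/eqP.
Qed.

Lemma ordn_dvd i : (a ^ i == 1 %[mod k]) = (ordn k a %| i).
Proof.
apply/eqP/idP => [ai | /dvdnP[j ->]]; last first.
  by rewrite mulnC expnM -modnXm ordnP modnXm exp1n.
rewrite /dvdn; apply/negPn/negP=> r0; set r := i %% ordn k a in r0.
have ro : r < ordn k a by rewrite ltn_mod.
have ar : a ^ r = 1 %[mod k].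
  move: ai; rewrite {1}(divn_eq i (ordn k a)) expnD [_ * ordn k a]mulnC expnM.
  by rewrite -modnMml -modnXm ordnP modnXm exp1n modnMml mul1n.
have lt_r : r.-1 < find Q (iota 0 k) by move: ro r0; rewrite /ordn -/Q; lia.
have := before_find 0 lt_r; rewrite nth_iota; last first.
  by apply: leq_trans lt_r _; rewrite -[X in _ <= X](size_iota 0 k) find_size.
by rewrite /Q add0n prednK ?lt0n // ar eqxx.
Qed.

End MultiplicativeOrder.

(** * Lifting congruences from [l] to powers of [l] *)

Section PrimePowers.
Variable l : nat.
Hypotheses (l_prime : prime l) (l_odd : odd l).

(** In a^l - 1 = (a - 1)(1 + a + ... + a^(l-1)), the second factor is a sum of [l] terms congruent
    to 1 modulo [l]. *)
Lemma dvdn_exp_prime_lift r a : 0 < r -> l ^ r %| a - 1 -> l ^ r.+1 %| a ^ l - 1.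
Proof.
(* For [a = 0] truncated subtraction makes both differences 0. *)
move=> r0; case: (posnP a) => [-> _|a0 lra]; first by rewrite exp0n ?prime_gt0.
have la : a = 1 %[mod l].
  by apply/eqP; rewrite eqn_mod_dvd // (dvdn_trans _ lra) // dvdn_exp.
rewrite -{1}(exp1n l) subn_exp expnS mulnC dvdn_mul //.
rewrite /dvdn -modn_summ (eq_bigr (fun=> 1 %% l)) => [|i _]; last first.
  by rewrite exp1n muln1 -modnXm la modnXm exp1n.
by rewrite modn_summ sum_nat_const card_ord muln1 modnn.
Qed.

Lemma dvdn_exp_lift j r a : 0 < r -> l ^ r %| a - 1 -> l ^ (r + j) %| a ^ (l ^ j) - 1.
Proof.
move=> r0 lra; elim: j => [|j IH]; first by rewrite addn0 expn1.
by rewrite addnS [l ^ j.+1]expnSr expnM dvdn_exp_prime_lift // addn_gt0 r0.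
Qed.

Lemma dvdn_addn1 r x : 0 < x -> l ^ r %| x ^ 2 - 1 -> ~~ (l %| x - 1) -> l ^ r %| x + 1.
Proof.
move=> x0 lx nlx; have : l ^ r %| (x - 1) * (x + 1) by rewrite -subn_sqr exp1n.
by rewrite Gauss_dvdr // coprimeXl // prime_coprime.
Qed.

Variables (q m : nat).
Hypotheses (m_gt0 : 0 < m) (coql : coprime q l).
Local Notation f := (ordn l q).
Local Notation k := (l ^ m).

Let q_gt0 : 0 < q := coprime_prime_gt0 l_prime coql.

Lemma ordn_lift : k %| q ^ (f * l ^ m.-1) - 1.
Proof.
have : l ^ (1 + m.-1) %| (q ^ f) ^ (l ^ m.-1) - 1.
  apply: dvdn_exp_lift => //; rewrite expn1 -eqn_mod_dvd ?expn_gt0 ?q_gt0 //.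
  by apply/eqP/ordnP; rewrite ?prime_gt1.
by rewrite add1n prednK // -expnM.
Qed.

(** The square of this power of [q] is 1 modulo [k]. The power itself is not 1 modulo [l], since [f]
    does not divide an odd multiple of its half; so it is -1 modulo [k]. *)
Lemma ordn_half_lift : ~~ odd f -> k %| q ^ (f./2 * l ^ m.-1) + 1.
Proof.
move=> fe; apply: dvdn_addn1; first by rewrite expn_gt0 q_gt0.
  rewrite -expnM mulnAC muln2 even_halfK //; exact: ordn_lift.
rewrite -eqn_mod_dvd ?expn_gt0 ?q_gt0 // ordn_dvd ?prime_gt1 //.
rewrite -{1}(even_halfK fe) -muln2 dvdn_pmul2l; last first.
  by case: (ordn l q) (isT : 0 < ordn l q) fe => [|[]].
by rewrite dvdn2 negbK oddX l_odd orbT.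
Qed.

(** If [l] did not divide [q ^ i - 1], that factor would be invertible modulo [k] and [k] would
    divide [t]. *)
Lemma ordn_dvd_fixed t i : ~~ (k %| t) -> t * q ^ i = t %[mod k] -> f %| i.
Proof.
move=> nt /eqP; rewrite eqn_mod_dvd; last by rewrite leq_pmulr // expn_gt0 q_gt0.
rewrite -{2}[t]muln1 -mulnBr => kt; rewrite -ordn_dvd ?prime_gt1 // eqn_mod_dvd ?expn_gt0 ?q_gt0 //.
apply: contraR nt => nl; rewrite -(Gauss_dvdl _ (_ : coprime _ (q ^ i - 1))) //.
by rewrite coprimeXl // prime_coprime.
Qed.

End PrimePowers.

(** * Units modulo [l ^ r] up to sign and powers of [q], through discrete logarithms *)

Section PrimitiveRoots.
Variables (l m g : nat).
Hypotheses (l_prime : prime l) (l_odd : odd l) (m_gt0 : 0 < m).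
Hypotheses (cogl : coprime g l) (g_prim : ordn (l ^ m) g = totient (l ^ m)).

Let l_gt1 : 1 < l := prime_gt1 l_prime.

Let g_gt0 : 0 < g := coprime_prime_gt0 l_prime cogl.

Let gX_gt0 i : 0 < g ^ i. Proof. by rewrite expn_gt0 g_gt0. Qed.

Variable r : nat.
Hypotheses (r_gt0 : 0 < r) (le_rm : r <= m).
Local Notation phi := (totient (l ^ r)).

Let lr_gt1 : 1 < l ^ r. Proof. by rewrite -(exp1n r) ltn_exp2r. Qed.

Let totient_split : totient (l ^ m) = phi * l ^ (m - r).
Proof.
by rewrite !totient_pfactor // -mulnA -expnD; congr (_ * l ^ _); lia.
Qed.

(** A generator modulo [l ^ m] remains one modulo [l ^ r]: lifting [g ^ a = 1] from level [r] to
    level [m] multiplies the exponent by [l ^ (m - r)], exactly the ratio of the two totients. *)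
Lemma primroot_exp_eq1 a : (g ^ a == 1 %[mod l ^ r]) = (phi %| a).
Proof.
apply/idP/idP => [|/dvdnP[j ->]]; last first.
  by rewrite mulnC expnM -modnXm Euler_exp_totient ?coprimeXr // modnXm exp1n.
rewrite eqn_mod_dvd // => /(dvdn_exp_lift l_prime (m - r) r_gt0).
rewrite subnKC // -expnM -eqn_mod_dvd // ordn_dvd ?coprimeXr //; last first.
  by rewrite -(exp1n m) ltn_exp2r.
by rewrite g_prim totient_split dvdn_pmul2r // expn_gt0 ltnW.
Qed.

Lemma primroot_exp_eq a b : (g ^ a == g ^ b %[mod l ^ r]) = (a == b %[mod phi]).
Proof.
wlog ba : a b / b <= a.
  by move=> H; case: (leqP b a) => [/H // | /ltnW/H]; rewrite eq_sym [RHS]eq_sym.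
rewrite !eqn_mod_dvd ?leq_pexp2l // -primroot_exp_eq1 eqn_mod_dvd //.
rewrite -{1}(subnK ba) expnD -{2}[g ^ b]mul1n -mulnBl Gauss_dvdl //.
by rewrite coprimeXl // coprimeXr // coprime_sym.
Qed.

Lemma primroot_log t : coprime t l -> exists a, t = g ^ a %[mod l ^ r].
Proof.
move=> cotl.
pose s1 := [seq g ^ a %% l ^ r | a <- iota 0 phi].
pose s2 := [seq x <- iota 0 (l ^ r) | coprime (l ^ r) x].
have u1 : uniq s1.
  rewrite map_inj_in_uniq ?iota_uniq // => a b; rewrite !mem_iota /= => a1 b1 /eqP.
  by rewrite primroot_exp_eq !modn_small // => /eqP.
have sub : {subset s1 <= s2}.
  move=> _ /mapP[a _ ->]; rewrite mem_filter mem_iota /= ltn_mod (ltnW lr_gt1).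
  by rewrite coprime_modr coprime_sym coprimeXl // coprimeXr.
have [] := uniq_min_size u1 sub _; last first.
  move=> _ /(_ (t %% l ^ r)); rewrite mem_filter mem_iota /= ltn_mod (ltnW lr_gt1).
  rewrite coprime_modr coprime_sym coprimeXr // => /mapP[a _ e]; exists a; exact: e.
rewrite size_map size_iota size_filter totient_count_coprime /index_iota subn0.
by rewrite -sum1_count [X in X <= _]big_mkcond /=; apply: leq_sum => i _; case: coprime.
Qed.

Let phi_even : ~~ odd phi.
Proof. by rewrite totient_pfactor // oddM -subn1 oddB ?l_odd // prime_gt0. Qed.

Lemma primroot_half : l ^ r %| g ^ phi./2 + 1.
Proof.
apply: dvdn_addn1 => //.
  by rewrite -expnM muln2 even_halfK // -eqn_mod_dvd // primroot_exp_eq1.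
(* Being 1 modulo [l] would lift to level [r], making [phi] divide an odd multiple of [phi./2]. *)
apply/negP=> lg.
have : l ^ r %| (g ^ phi./2) ^ (l ^ r.-1) - 1.
  by rewrite -{1}(prednK r_gt0) -add1n dvdn_exp_lift.
rewrite -expnM -eqn_mod_dvd // primroot_exp_eq1 -{1}(even_halfK phi_even) -muln2.
rewrite dvdn_pmul2l ?dvdn2 ?oddX ?l_odd ?orbT //.
have : 0 < phi by rewrite totient_gt0 ltnW.
by case: phi phi_even => [|[]].
Qed.

Variable q : nat.
Hypotheses (coql : coprime q l) (odd_ord : odd (ordn (l ^ r) q)).
Local Notation lam := (ordn (l ^ r) q).
Local Notation delta := (phi %/ lam).

Let lam_delta : phi = delta * lam.
Proof.
by rewrite divnK // -ordn_dvd ?coprimeXr // Euler_exp_totient // coprimeXr.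
Qed.

Let delta_dvd : delta %| phi.
Proof. by rewrite [X in _ %| X]lam_delta dvdn_mulr. Qed.

Lemma delta_even : ~~ odd delta.
Proof. by have := phi_even; rewrite {1}lam_delta oddM odd_ord andbT. Qed.

Let delta_gt0 : 0 < delta.
Proof.
have : 0 < phi by rewrite totient_gt0 ltnW.
by rewrite {1}lam_delta muln_gt0 => /andP[].
Qed.

(** With [w] the logarithm of [q], [delta] is gcd(w, phi); so the powers of [q] are the powers of
    [g ^ delta], and [y] is the Bezout coefficient that writes [g ^ delta] as a power of [q]. *)
Let log_q : exists2 w, q = g ^ w %[mod l ^ r] &
  exists2 x, delta * x = w & exists y, w * y = delta %[mod phi].
Proof.
have [w0 qw0] := primroot_log coql.
(* Adding [phi] makes the logarithm positive, as [egcdnP] requires. *)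
pose w := w0 + phi; have w_gt0 : 0 < w by rewrite addn_gt0 totient_gt0 (ltnW lr_gt1) orbT.
have qw : q = g ^ w %[mod l ^ r].
  by rewrite qw0; apply/eqP; rewrite primroot_exp_eq /w modnDr.
have q_w i : (q ^ i == 1 %[mod l ^ r]) = (phi %| w * i).
  by rewrite -modnXm qw modnXm -expnM primroot_exp_eq1.
have dw : delta %| w.
  have : phi %| w * lam by rewrite -q_w; apply/eqP/ordnP; rewrite ?coprimeXr.
  by rewrite {1}lam_delta dvdn_pmul2r.
have gd : gcdn w phi = delta.
  apply/eqP; rewrite eqn_dvd dvdn_gcd dw delta_dvd andbT.
  set c := gcdn w phi.
  have c0 : 0 < c by rewrite gcdn_gt0 w_gt0.
  have cphi : c %| phi by rewrite dvdn_gcdr.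
  have : lam %| phi %/ c.
    rewrite -ordn_dvd ?coprimeXr // q_w -(divnK (dvdn_gcdl w phi : c %| w)) -mulnA.
    by rewrite [c * _]mulnC divnK // dvdn_mull.
  case/dvdnP=> z ez; have : phi = c * z * lam by rewrite -mulnA -ez mulnC divnK.
  rewrite {1}lam_delta => /eqP; rewrite eqn_pmul2r // => /eqP->; rewrite dvdn_mulr //.
exists w => //; exists (w %/ delta); first by rewrite mulnC divnK.
have [y z eyz _] := egcdnP phi w_gt0; exists y.
by rewrite mulnC eyz gd modnMDl.
Qed.

(** As [lam] is odd, [phi./2] is [delta./2] modulo [delta]: up to powers of [q], -1 is
    [g ^ delta./2]. Hence exponents below [delta./2] represent the units up to sign. *)
Let half_split : phi./2 = delta./2 + delta * lam./2.
Proof.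
have := odd_double_half lam; have := even_halfK delta_even; have := even_halfK phi_even.
rewrite {2}lam_delta odd_ord; move: (phi./2) (delta) (lam) => a b c; nia.
Qed.

Let half_lt j : j < delta./2 -> j < delta.
Proof. by move/leq_trans; apply; rewrite -{2}(even_halfK delta_even) -addnn leq_addr. Qed.

Lemma delta_unique j j' i : j < delta./2 -> j' < delta./2 ->
  g ^ j = g ^ j' * q ^ i %[mod l ^ r] -> j = j'.
Proof.
move=> jd j'd; have [w qw [x xw _]] := log_q.
have qX : q ^ i = g ^ (w * i) %[mod l ^ r] by rewrite -modnXm qw modnXm -expnM.
rewrite -modnMmr qX modnMmr -expnD => /eqP.
rewrite primroot_exp_eq -xw => /eqP/(congr1 (modn^~ delta)).
rewrite !modn_dvdm //.
have -> : j' + delta * x * i = x * i * delta + j' by ring.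
by rewrite modnMDl (modn_small (half_lt jd)) (modn_small (half_lt j'd)).
Qed.

Lemma delta_opp j j' i : j < delta./2 -> j' < delta./2 ->
  ~~ (l ^ r %| g ^ j + g ^ j' * q ^ i).
Proof.
move=> jd j'd; apply/negP=> dvd; have [w qw [x xw _]] := log_q.
have qX : q ^ i = g ^ (w * i) %[mod l ^ r] by rewrite -modnXm qw modnXm -expnM.
have : g ^ j = g ^ (phi./2 + j' + w * i) %[mod l ^ r].
  rewrite expnD -[in RHS]modnMmr -qX modnMmr expnD -mulnA.
  apply/eqP; rewrite -(eqn_modDr (g ^ j' * q ^ i)) -mulSnr -addn1.
  by rewrite (eqP dvd) eq_sym; apply: dvdn_mulr; apply: primroot_half.
move/eqP; rewrite primroot_exp_eq -xw => /eqP/(congr1 (modn^~ delta)).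
rewrite !modn_dvdm // half_split.
have -> : delta./2 + delta * lam./2 + j' + delta * x * i =
          (lam./2 + x * i) * delta + (delta./2 + j') by ring.
have lt_d : delta./2 + j' < delta.
  by rewrite -[X in _ < X](even_halfK delta_even) -addnn ltn_add2l.
rewrite modnMDl (modn_small (half_lt jd)) (modn_small lt_d) => ej.
by move: jd; rewrite ej ltnNge leq_addr.
Qed.

Lemma delta_cover t : coprime t l -> exists2 j, j < delta./2 & exists i,
  t = g ^ j * q ^ i %[mod l ^ r] \/ l ^ r %| t + g ^ j * q ^ i.
Proof.
move=> /primroot_log[a ta]; have [w qw [x xw [y yw]]] := log_q.
have q_delta z : q ^ (y * z) = g ^ (delta * z) %[mod l ^ r].
  rewrite -modnXm qw modnXm -expnM mulnA; apply/eqP; rewrite primroot_exp_eq.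
  by rewrite -modnMml yw modnMml.
have := divn_eq a delta; have := ltn_pmod a delta_gt0.
set j := a %% delta; set z := a %/ delta => jd ea.
have ed := even_halfK delta_even.
have [j_lt | j_ge] := ltnP j delta./2.
  exists j => //; exists (y * z); left.
  by rewrite ta ea addnC expnD [z * _]mulnC -[LHS]modnMmr -q_delta modnMmr.
exists (j - delta./2); first by rewrite -(ltn_add2r delta./2) subnK // addnn ed.
(* The exponent is chosen so that j - delta/2 + delta (z + lam./2 + 1) = a + phi/2, and [g ^ phi./2]
   is -1. *)
exists (y * (z + lam./2.+1)); right.
rewrite /dvdn; have -> : t + g ^ (j - delta./2) * q ^ (y * (z + lam./2.+1)) =
          t + g ^ phi./2 * g ^ a %[mod l ^ r]; last first.
  by rewrite -modnDml ta modnDml -mulSn -addn1; apply: (dvdn_mulr _ primroot_half).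
apply/eqP; rewrite eqn_modDl -modnMmr q_delta modnMmr -!expnD; apply/eqP; congr (g ^ _ %% _).
rewrite half_split ea; move: j_ge ed; rewrite -muln2; clearbody j z; clear.
move: (delta./2) (lam./2) (delta) => D2 L2 D j_ge <-; nia.
Qed.

End PrimitiveRoots.

(** * Nonzero classes modulo [l ^ m] up to sign and powers of [q] *)

Section Representatives.
Variables (l m g q : nat).
Hypotheses (l_prime : prime l) (l_odd : odd l) (m_gt0 : 0 < m).
Hypotheses (cogl : coprime g l) (g_prim : ordn (l ^ m) g = totient (l ^ m)).
Hypotheses (coql : coprime q l) (odd_f : odd (ordn l q)).
Local Notation delta r := (totient (l ^ r) %/ ordn (l ^ r) q).

Lemma odd_ordn_pow r : 0 < r -> r <= m -> odd (ordn (l ^ r) q).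
Proof.
move=> r0 rm; have : ordn (l ^ r) q %| ordn l q * l ^ m.-1.
  rewrite -ordn_dvd ?coprimeXr //; last by rewrite -(exp1n r) ltn_exp2r ?prime_gt1.
  rewrite eqn_mod_dvd ?(dvdn_trans (dvdn_exp2l l rm)) ?ordn_lift //.
  by rewrite expn_gt0 (coprime_prime_gt0 l_prime coql).
move/dvdnP=> [z ez]; have : odd (ordn l q * l ^ m.-1) by rewrite oddM odd_f oddX l_odd orbT.
by rewrite ez oddM => /andP[].
Qed.

(** The classes of additive order [l ^ r] are [l ^ (m - r)] times the units modulo [l ^ r]; [z.1] is
    this [r] and [z.2] the exponent of the unit. *)
Definition rep (z : nat * nat) := l ^ (m - z.1) * g ^ z.2.

Definition rep_idx : seq (nat * nat) :=
  [seq (r, j) | r <- index_iota 1 m.+1, j <- index_iota 0 (delta r)./2].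

Lemma mem_rep_idx z : (z \in rep_idx) = [&& 0 < z.1, z.1 <= m & z.2 < (delta z.1)./2].
Proof.
apply/allpairsPdep/and3P => [[r [j []]] | [r0 rm jd]].
  by rewrite !mem_index_iota ltnS => /andP[r0 rm] jd -> /=.
by exists z.1, z.2; rewrite !mem_index_iota r0 ltnS rm jd; case: z {r0 rm jd}.
Qed.

Lemma uniq_rep_idx : uniq rep_idx.
Proof.
apply: allpairs_uniq_dep; rewrite ?iota_uniq //; first by move=> *; rewrite iota_uniq.
by move=> [r j] [r' j'] _ _ /= [-> ->].
Qed.

(** A comparison of [l]-adic valuations. Below [m] these are unaffected by reduction modulo [l ^ m]
    and by sign, so equality and opposition are treated together. *)
Let val_le a b x y : a < m -> coprime y l ->
  l ^ b * x = l ^ a * y %[mod l ^ m] \/ l ^ m %| l ^ b * x + l ^ a * y -> b <= a.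
Proof.
move=> am coyl H; rewrite leqNgt; apply/negP=> ab.
have lx : l ^ a.+1 %| l ^ b * x by rewrite dvdn_mulr // dvdn_exp2l.
have lm : l ^ a.+1 %| l ^ m by rewrite dvdn_exp2l.
suff : l ^ a.+1 %| l ^ a * y.
  rewrite expnSr dvdn_pmul2l ?expn_gt0 ?prime_gt0 // => ly.
  by move: coyl; rewrite coprime_sym prime_coprime // ly.
case: H => [e | dv]; last by rewrite -(dvdn_addr _ lx) (dvdn_trans lm).
by move: lx; rewrite /dvdn -(modn_dvdm _ lm) e modn_dvdm.
Qed.

Let coprime_unit j i : coprime (g ^ j * q ^ i) l.
Proof. by rewrite coprimeMl !coprimeXl. Qed.

Let rep_same_r z z' i : z \in rep_idx -> z' \in rep_idx ->
  rep z = rep z' * q ^ i %[mod l ^ m] \/ l ^ m %| rep z + rep z' * q ^ i -> z.1 = z'.1.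
Proof.
rewrite !mem_rep_idx => /and3P[r0 rm _] /and3P[r'0 r'm _]; rewrite /rep -mulnA => H.
have H1 : m - z.1 <= m - z'.1 by apply: val_le H; [rewrite ltn_subrL r'0 | exact: coprime_unit].
have H2 : m - z'.1 <= m - z.1.
  apply: (@val_le _ _ (g ^ z'.2 * q ^ i) (g ^ z.2)).
  - by rewrite ltn_subrL r0.
  - by rewrite coprimeXl.
  - by rewrite addnC; case: H; [left | right].
move: (z.1) (z'.1) r0 rm r'0 r'm H1 H2; clear; lia.
Qed.

Lemma rep_unique z z' i : z \in rep_idx -> z' \in rep_idx ->
  rep z = rep z' * q ^ i %[mod l ^ m] -> z = z'.
Proof.
move=> zi z'i e; have er := rep_same_r zi z'i (or_introl e).
move: zi z'i e; rewrite !mem_rep_idx /rep; case: z z' er => [r j] [_ j'] /= <-.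
case/and3P=> r0 rm jd /and3P[_ _ j'd]; rewrite -mulnA -{2 4}(subnK rm) expnD -!muln_modr.
move/eqP; rewrite eqn_pmul2l ?expn_gt0 ?prime_gt0 // => /eqP e; congr (_, _).
exact: (delta_unique l_prime l_odd m_gt0 cogl g_prim r0 rm coql (odd_ordn_pow r0 rm) jd j'd e).
Qed.

Lemma rep_opp z z' i : z \in rep_idx -> z' \in rep_idx ->
  ~~ (l ^ m %| rep z + rep z' * q ^ i).
Proof.
move=> zi z'i; apply/negP=> e; have er := rep_same_r zi z'i (or_intror e).
move: zi z'i e; rewrite !mem_rep_idx /rep; case: z z' er => [r j] [_ j'] /= <-.
case/and3P=> r0 rm jd /and3P[_ _ j'd]; rewrite -mulnA -mulnDr -{1}(subnK rm) expnD.
rewrite dvdn_pmul2l ?expn_gt0 ?prime_gt0 //; apply/negP.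
exact: (delta_opp l_prime l_odd m_gt0 cogl g_prim r0 rm coql (odd_ordn_pow r0 rm) _ jd j'd).
Qed.

Lemma rep_cover t : 0 < t -> t < l ^ m -> exists2 z, z \in rep_idx & exists i,
  t = rep z * q ^ i %[mod l ^ m] \/ l ^ m %| t + rep z * q ^ i.
Proof.
move=> t0 tm; have [t' cot' et] := pfactor_coprime l_prime t0.
set a := logn l t in et; have am : a < m.
  rewrite -(ltn_exp2l _ _ (prime_gt1 l_prime)) (leq_ltn_trans _ tm) // et leq_pmull //.
  by rewrite lt0n; apply: contraTneq t0 => t'0; rewrite et t'0.
pose r := m - a; have r0 : 0 < r by rewrite subn_gt0.
have rm : r <= m by rewrite leq_subr.
rewrite coprime_sym in cot'.
have [j jd [i H]] :=
  delta_cover l_prime l_odd m_gt0 cogl g_prim r0 rm coql (odd_ordn_pow r0 rm) cot'.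
exists (r, j); first by rewrite mem_rep_idx /= r0 rm.
have ea : m - r = a by rewrite subKn // ltnW.
exists i; rewrite /rep /= ea -mulnA et mulnC.
have em : l ^ m = l ^ a * l ^ r by rewrite -expnD addnC subnK // ltnW.
case: H => [e | dv]; [left | right].
  by rewrite em -!muln_modr e.
by rewrite em -mulnDr dvdn_pmul2l // expn_gt0 prime_gt0.
Qed.

End Representatives.

(** * Cyclotomic cosets *)

Section CyclotomicCosets.
Variables (k q : nat).
Hypotheses (k_gt0 : 0 < k) (coqk : coprime q k).

Lemma mem_cyc t u : u \in cyc k q t <-> exists i, u = (t * q ^ i) %% k.
Proof.
rewrite /cyc mem_undup; split=> [/mapP[i _ ->] | [i ->]]; first by exists i.
have [T /andP[T0 Tk] qT] := coprime_exp_period coqk k_gt0.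
apply/mapP; exists (i %% T); first by rewrite mem_iota /= add0n (leq_trans _ Tk) // ltn_mod.
rewrite {1}(divn_eq i T) expnD mulnA -modnMml -[(t * _) %% k]modnMmr [_ * T]mulnC qT.
by rewrite modnMmr muln1 modnMml.
Qed.

Lemma uniq_cyc t : uniq (cyc k q t). Proof. exact: undup_uniq. Qed.

Lemma cyc_lt t u : u \in cyc k q t -> u < k.
Proof. by case/mem_cyc=> i ->; rewrite ltn_mod. Qed.

Lemma cyc0 : cyc k q 0 = [:: 0].
Proof.
apply: perm_small_eq => //; apply: uniq_perm; rewrite ?uniq_cyc // => u.
rewrite inE; apply/idP/eqP => [/mem_cyc[i ->] | ->]; first by rewrite mul0n mod0n.
by apply/mem_cyc; exists 0; rewrite mod0n.
Qed.

Lemma coset_sym t u i : u = t * q ^ i %[mod k] -> exists j, t = u * q ^ j %[mod k].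
Proof.
move=> ut; have [T /andP[T0 _] qT] := coprime_exp_period coqk k_gt0.
exists (T.-1 * i); rewrite -modnMml ut modnMml -mulnA -expnD -{1}[i]mul1n -mulnDl add1n prednK //.
by rewrite -modnMmr qT modnMmr muln1.
Qed.

Lemma negm_add t : k %| negm k t + t.
Proof.
by rewrite /dvdn /negm modnDml -modnDmr subnK ?modnn // ltnW // ltn_mod.
Qed.

Lemma eq_negm t u : (u == negm k t %[mod k]) = (k %| u + t).
Proof. by rewrite -(eqn_modDr t) (eqP (negm_add t)). Qed.

Lemma negm_mul t x : negm k t * x = negm k (t * x) %[mod k].
Proof. by apply/eqP; rewrite eq_negm -mulnDl dvdn_mulr // negm_add. Qed.

Variables (e : nat) (rh : nat -> nat).
Hypothesis rh0 : rh 0 = 0.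
Hypothesis rh_lt : forall i, i <= e -> rh i < k.
Hypothesis rh_distinct : forall i j, i <= e -> j <= e -> rh i \in cyc k q (rh j) -> i = j.
Hypothesis rh_cover : forall t, t < k -> exists2 i, i <= e & t \in cyc k q (rh i).

Lemma rh_eq i j u : i <= e -> j <= e -> rh i = rh j * q ^ u %[mod k] -> i = j.
Proof.
move=> ie je eij; apply: rh_distinct => //; apply/mem_cyc; exists u.
by rewrite -eij modn_small // rh_lt.
Qed.

Lemma rh_cov t : exists2 i, i <= e & exists u, t = rh i * q ^ u %[mod k].
Proof.
have [|i ie /mem_cyc[u tu]] := @rh_cover (t %% k); first by rewrite ltn_mod.
by exists i => //; exists u.
Qed.

Lemma rh_gt0 i : 0 < i -> i <= e -> 0 < rh i.
Proof.
move=> i0 ie; rewrite lt0n; apply: contraTneq i0 => ri; rewrite -eqn0Ngt.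
by apply/eqP/(@rh_eq i 0 0); rewrite // ri rh0.
Qed.

Lemma rh_ndvd i : 0 < i -> i <= e -> ~~ (k %| rh i).
Proof. by move=> i0 ie; rewrite gtnNdvd ?rh_gt0 ?rh_lt. Qed.

(* The hypotheses on [Z] and [r] say that the [r z] and their opposites represent the
   nonzero cosets. *)
Lemma count_cosets (K : eqType) (Z : seq K) (r : K -> nat) : uniq Z ->
  (forall z z' i, z \in Z -> z' \in Z -> r z = r z' * q ^ i %[mod k] -> z = z') ->
  (forall z z' i, z \in Z -> z' \in Z -> ~~ (k %| r z + r z' * q ^ i)) ->
  (forall t, 0 < t -> t < k -> exists2 z, z \in Z & exists i,
      t = r z * q ^ i %[mod k] \/ k %| t + r z * q ^ i) ->
  e = (size Z).*2.
Proof.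
move=> uZ r_uniq r_opp r_cov.
pose cls t := find (fun i => t %% k \in cyc k q (rh i)) (iota 0 e.+1).
have clsP t : cls t <= e /\ exists u, t = rh (cls t) * q ^ u %[mod k].
  have hs : has (fun i => t %% k \in cyc k q (rh i)) (iota 0 e.+1).
    have [|i ie ti] := @rh_cover (t %% k); first by rewrite ltn_mod.
    by apply/hasP; exists i; rewrite // mem_iota.
  have lt_c : cls t < e.+1 by move: hs; rewrite has_find size_iota.
  split=> //; have := nth_find 0 hs; rewrite nth_iota // add0n => /mem_cyc[u tu].
  by exists u.
have cls_eq t i u : i <= e -> t = rh i * q ^ u %[mod k] -> cls t = i.
  move=> ie ti; have [ce [v tv]] := clsP t.
  have [w iw] := coset_sym ti; symmetry; apply: (@rh_eq i (cls t) (v + w)) => //.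
  by rewrite iw -modnMml tv modnMml -mulnA -expnD.
have cls_inj t t' : cls t = cls t' -> exists u, t = t' * q ^ u %[mod k].
  move=> ett'; have [_ [u tu]] := clsP t; have [_ [v /coset_sym[w t'v]]] := clsP t'.
  exists (w + u); rewrite tu ett' -modnMml t'v modnMml -mulnA -expnD //.
(* The flag selects a representative or its opposite; the classes of all these values turn out to be
   exactly 1, ..., e, each once. *)
pose t (zs : K * bool) := if zs.2 then negm k (r zs.1) else r zs.1.
pose J := [seq cls (t zs) | zs <- [seq (z, s) | z <- Z, s <- [:: false; true]]].
have -> : (size Z).*2 = size J by rewrite size_map size_allpairs muln2.
have neg_mod x y i : negm k x = y * q ^ i %[mod k] -> k %| x + y * q ^ i.
  by move/eqP; rewrite eq_sym eq_negm addnC.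
have [uJ memJ] : uniq J /\ J =i iota 1 e; last first.
  by have /perm_size := uniq_perm uJ (iota_uniq 1 e) memJ; rewrite size_iota.
split.
  rewrite map_inj_in_uniq; first by apply: allpairs_uniq => // -[? ?] [? ?] _ _ [-> ->].
  move=> zs1 zs2 /allpairsP[[z s] [zZ _ ->]] /allpairsP[[z' s'] [z'Z _ ->]].
  rewrite /= in zZ z'Z; case/cls_inj=> u; rewrite /t /=; case: s s' => [] [] /=.
  - move=> H; congr (_, _); apply: (r_uniq _ _ u) => //.
    have dv : k %| negm k (r z) + r z' * q ^ u by rewrite -eq_negm H negm_mul.
    by apply/eqP; rewrite -(eqn_modDl (negm k (r z))) (eqP (negm_add _)) eq_sym.
  - by move/neg_mod; rewrite (negPf (r_opp _ _ _ _ _)).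
  - move=> H; have : k %| r z + r z' * q ^ u; last by rewrite (negPf (r_opp _ _ _ _ _)).
    by rewrite /dvdn -modnDml H modnDml -mulnDl -/(dvdn _ _) dvdn_mulr // negm_add.
  - by move=> H; congr (_, _); apply: r_uniq H.
move=> i; rewrite mem_iota add1n ltnS.
apply/mapP/andP => [[_ /allpairsP[[z s] [/= zZ _ ->]] ->] | [i0 ie]].
  have [ce [u tu]] := clsP (t (z, s)); split=> //; rewrite lt0n; apply/negP=> /eqP c0.
  have : k %| t (z, s) by rewrite /dvdn tu c0 rh0 mul0n mod0n.
  have nz : ~~ (k %| r z).
    by apply: contra (r_opp z z 0 zZ zZ) => kz; rewrite dvdn_add // dvdn_mulr.
  rewrite /t; case: s {tu c0 ce} => /=; last by rewrite (negPf nz).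
  move=> kn; move: nz; rewrite -(dvdn_addr _ kn) negm_add //.
have [z zZ [u H]] := r_cov _ (rh_gt0 i0 ie) (rh_lt ie).
case: H => [e1 | dv].
  exists (z, false); first by apply/allpairsP; exists (z, false).
  by have [v zv] := coset_sym e1; rewrite (cls_eq _ _ _ ie zv).
exists (z, true); first by apply/allpairsP; exists (z, true).
have /eqP e1 : rh i == negm k (r z) * q ^ u %[mod k] by rewrite negm_mul eq_negm.
by have [v zv] := coset_sym e1; rewrite (cls_eq _ _ _ ie zv).
Qed.

End CyclotomicCosets.

Local Open Scope ring_scope.

(** * The roots of [X^(2 k) + 1] *)

Section HatPolynomials.
Variables (L : fieldType) (eta c : L) (k q t : nat).
Hypothesis c_neq0 : c != 0.

(** Substituting c X turns X - eta^s into c (X - c^-1 eta^s), and [hatp] removes the constants. *)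
Lemma hatp_scalX :
  hatp (scalX (Mpoly eta k q t) c) =
  \prod_(x <- [seq c^-1 * eta ^+ s | s <- cyc k q t]) ('X - x%:P).
Proof.
rewrite /hatp /scalX /Mpoly; set r := cyc k q t.
have -> : (\prod_(s <- r) ('X - (eta ^+ s)%:P)) \Po (c *: 'X) =
  c ^+ size r *: \prod_(x <- [seq c^-1 * eta ^+ s | s <- r]) ('X - x%:P).
  elim: r => [|s r IH]; first by rewrite !big_nil comp_polyC scale1r.
  rewrite !big_cons comp_polyM {}IH /= exprSr -scalerA -scalerAr; congr (_ *: _).
  rewrite comp_polyB comp_polyX comp_polyC scalerAl scalerBr; congr ((_ - _) * _).
  by rewrite -mul_polyC -polyCM mulVKf.
rewrite lead_coefZ (monicP (monic_prod_XsubC _ _ _)) mulr1 scalerA mulVf ?scale1r //.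
exact: expf_neq0.
Qed.

End HatPolynomials.

(** * Coordinates (sign, exponent) on the roots; [a] tells whether the [q]-power map negates [c] *)

Section Points.
Variables (L : fieldType) (eta c : L) (k q : nat) (a : bool).
Hypotheses (k_odd : odd k) (q_odd : odd q) (coqk : coprime q k).
Hypotheses (eta_prim : k.-primitive_root eta) (c_sqr : c ^+ 2 = -1).
Hypothesis c_frob : c ^+ q = (-1) ^+ a * c.
Hypothesis neg1_neq1 : (-1 : L) != 1.

Let k_gt0 : (0 < k)%N. Proof. by case: (k) k_odd. Qed.

Let c_neq0 : c != 0.
Proof. by apply: contra_eqN c_sqr => /eqP->; rewrite expr0n /= eq_sym oppr_eq0 oner_eq0. Qed.

(** The inverse of [c] appears because these are zeros of polynomials evaluated at c X ([s] false)
    or at -c X ([s] true). *)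
Definition tpoint (s : bool) (t : nat) : L := (-1) ^+ s * c^-1 * eta ^+ t.

Let pt_nz s : (-1) ^+ s * c^-1 != 0.
Proof. by rewrite mulf_neq0 ?invr_eq0 // signr_eq0. Qed.

Lemma pt_root s t : tpoint s t ^+ (2 * k) = -1.
Proof.
have e2 : tpoint s t ^+ 2 = - (eta ^+ t ^+ 2).
  by rewrite /tpoint !exprMn sqrr_sign mul1r exprVn c_sqr invrN1 mulN1r.
rewrite exprM e2 exprNn -signr_odd k_odd -!exprM [(_ * k)%N]mulnC exprM.
by rewrite (prim_expr_order eta_prim) expr1n mulr1.
Qed.

Lemma pt_mod s t : tpoint s (t %% k) = tpoint s t.
Proof. by rewrite /tpoint prim_expr_mod. Qed.

Let pt_expk s t : tpoint s t ^+ k = (-1) ^+ s * c^-1 ^+ k.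
Proof.
rewrite /tpoint exprMn exprAC (prim_expr_order eta_prim) expr1n mulr1 exprMn; congr (_ * _).
by rewrite exprAC -[in LHS]signr_odd k_odd.
Qed.

Lemma pt_inj s s' t t' : tpoint s t = tpoint s' t' -> s = s' /\ t = t' %[mod k].
Proof.
move=> e; have es : s = s'.
  (* The [k]-th power kills [eta] and, [k] being odd, keeps the sign. *)
  have := congr1 (fun x => x ^+ k) e; rewrite !pt_expk.
  have ck : c^-1 ^+ k != 0 by rewrite expf_neq0 // invr_eq0.
  move/(mulIf ck); case: s s' {e} => [] [] //= /eqP; first by rewrite (negPf neg1_neq1).
  by rewrite eq_sym (negPf neg1_neq1).
split=> //; move: e; rewrite /tpoint es => /(mulfI (pt_nz s'))/eqP.
by rewrite (eq_prim_root_expr eta_prim) => /eqP.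
Qed.

Lemma pt_eq s t t' : t = t' %[mod k] -> tpoint s t = tpoint s t'.
Proof. by move=> e; rewrite -pt_mod e pt_mod. Qed.

Lemma pt_surj x : x ^+ (2 * k) = -1 -> exists s t, x = tpoint s t.
Proof.
(* So [(c * x) ^+ k] is 1 or -1, and since [k] is odd that sign can be absorbed into [c * x],
   leaving a power of [eta]. *)
move=> xk; have : ((c * x) ^+ k) ^+ 2 = 1.
  by rewrite -exprM mulnC exprMn xk exprM c_sqr -signr_odd k_odd mulrNN mulr1.
move/eqP; rewrite sqrf_eq1 => cx.
have [s es] : exists s : bool, ((-1) ^+ s * (c * x)) ^+ k = 1.
  case/orP: cx => /eqP e; [exists false | exists true]; rewrite exprMn e ?expr0 ?expr1n ?mulr1 //.
  by rewrite expr1 -signr_odd k_odd mulrNN mulr1.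
have [t et] := prim_rootP eta_prim es; exists s, t.
by rewrite /tpoint -et mulrACA -signr_addb addbb mul1r mulKf.
Qed.

Lemma pt_inv s t : (tpoint s t)^-1 = tpoint (~~ s) (negm k t).
Proof.
apply: mulr1_eq.
rewrite /tpoint mulrACA -exprD [_ * (_ * _)]mulrACA -signr_addb addbN addbb expr1 -expr2 exprVn.
rewrite c_sqr invrN1 mulrNN mul1r -(prim_expr_mod eta_prim) addnC (eqP (negm_add k_gt0 t)).
by rewrite mulr1.
Qed.

Lemma pt_frob s t i : tpoint s t ^+ (q ^ i) = tpoint (s (+) (a && odd i)) (t * q ^ i).
Proof.
elim: i => [|i IH]; first by rewrite andbF addbF muln1 expr1.
rewrite expnSr exprM IH /tpoint !exprMn -[eta ^+ _ ^+ q]exprM mulnA; congr (_ * _).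
rewrite exprAC -[in (-1) ^+ q]signr_odd q_odd expr1 exprVn c_frob invfM.
rewrite -exprVn invrN1 mulrA -signr_addb; congr (_ ^+ _ * _).
by rewrite /=; case: (a) (s) (odd i) => [] [] [].
Qed.

Definition tpoints (s : bool) (q0 t : nat) : seq L := [seq tpoint s u | u <- cyc k q0 t].

Lemma uniq_pts s q0 t : coprime q0 k -> uniq (tpoints s q0 t).
Proof.
move=> co; rewrite map_inj_in_uniq ?uniq_cyc // => u v /(cyc_lt k_gt0 co) uk /(cyc_lt k_gt0 co) vk.
by case/pt_inj=> _; rewrite !modn_small.
Qed.

Lemma mem_pts s q0 t y : coprime q0 k ->
  y \in tpoints s q0 t <-> exists i, y = tpoint s (t * q0 ^ i).
Proof.
move=> co; split=> [/mapP[u /(mem_cyc k_gt0 co)[i ->] ->] | [i ->]].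
  by exists i; rewrite pt_mod.
apply/mapP; exists ((t * q0 ^ i) %% k)%N; last by rewrite pt_mod.
by apply/(mem_cyc k_gt0 co); exists i.
Qed.

Lemma prod_pts s q0 t : \prod_(x <- tpoints s q0 t) ('X - x%:P) =
  hatp (scalX (Mpoly eta k q0 t) (if s then - c else c)).
Proof.
rewrite hatp_scalX; last by case: s; rewrite ?oppr_eq0.
congr (\prod_(x <- _) _); apply: eq_map => u; rewrite /tpoint.
by case: s; rewrite ?expr0 ?mul1r // expr1 invrN mulN1r.
Qed.

Definition all_pts : seq L := [seq tpoint s t | s <- [:: false; true], t <- iota 0 k].

Lemma uniq_all_pts : uniq all_pts.
Proof.
apply: allpairs_uniq; rewrite ?iota_uniq //.
move=> [s t] [s' t'] /allpairsP[[s1 t1] [_ h1 [-> ->]]] /allpairsP[[s2 t2] [_ h2 [-> ->]]].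
move: h1 h2; rewrite !mem_iota /= => h1 h2 /pt_inj[->].
by rewrite !modn_small // => ->.
Qed.

Lemma size_all_pts : size all_pts = (2 * k)%N.
Proof. by rewrite size_allpairs size_iota. Qed.

Lemma root_all_pts x : x \in all_pts -> x ^+ (2 * k) = -1.
Proof. by case/allpairsP=> -[s t] [_ _ ->]; apply: pt_root. Qed.

Lemma qorbit_pt s t y : qorbit q (tpoint s t) y <-> exists i,
  y = tpoint (s (+) (a && odd i)) (t * q ^ i) \/
  y = tpoint (~~ s (+) (a && odd i)) (negm k t * q ^ i).
Proof.
split=> -[i H]; exists i; move: H; rewrite pt_frob pt_inv -addNb.
  case=> ->; [by left | right]; apply: pt_eq; exact/esym/negm_mul.
case=> ->; [by left | right]; apply: pt_eq; exact: negm_mul.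
Qed.

End Points.

(** * Shape of the orbits when the [q]-power map negates [c] *)

Section TwistedOrbits.
Variables (L : fieldType) (eta c : L) (k q : nat).
Hypotheses (k_odd : odd k) (q_odd : odd q).
Hypotheses (eta_prim : k.-primitive_root eta) (c_sqr : c ^+ 2 = -1).
Hypothesis c_frob : c ^+ q = - c.
Local Notation pt := (tpoint eta c).

Let k_gt0 : (0 < k)%N. Proof. by case: (k) k_odd. Qed.

Let c_frob1 : c ^+ q = (-1) ^+ true * c. Proof. by rewrite mulN1r. Qed.

Let qorbitE s t y := qorbit_pt k_odd q_odd eta_prim c_sqr c_frob1 s t y.

Lemma qorbit_odd_period u s t y : odd u -> q ^ u = 1 %[mod k] ->
  qorbit q (pt s t) y <->
  exists s' i, y = pt s' (t * q ^ i) \/ y = pt s' (negm k t * q ^ i).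
Proof.
move=> odd_u qu; rewrite qorbitE; split=> [[i [] ->] | [s' [i H]]].
- by do 2!eexists; left.
- by do 2!eexists; right.
(* Adding the odd period [u] to the exponent keeps the class and changes the parity, so either sign
   can be reached. *)
have shift x : pt s' (x * q ^ (i + u)) = pt s' (x * q ^ i).
  by apply: (pt_eq _ eta_prim); rewrite expnD mulnA -modnMmr qu modnMmr muln1.
case: H => ->.
  have [e | ne] := eqVneq s' (s (+) odd i); first by exists i; left; rewrite e.
  exists (i + u)%N; left; rewrite -shift; congr pt.
  by rewrite /= oddD odd_u; case: s s' (odd i) ne {shift} => [] [] [].
have [e | ne] := eqVneq s' (~~ s (+) odd i); first by exists i; right; rewrite e.
exists (i + u)%N; right; rewrite -shift; congr pt.
by rewrite /= oddD odd_u; case: s s' (odd i) ne {shift} => [] [] [].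
Qed.

Variable h : nat.
Hypothesis q_h : (k %| q ^ h + 1)%N.

Let pt_opp s t i : pt s (negm k t * q ^ i) = pt s (t * q ^ (h + i)).
Proof.
apply: (pt_eq _ eta_prim); rewrite expnD mulnA -[RHS]modnMml -[LHS]modnMml; congr (_ * _ %% _)%N.
by apply/esym/eqP; rewrite eq_negm // -{2}[t]muln1 -mulnDr dvdn_mull.
Qed.

Lemma qorbit_odd_half s t y : odd h ->
  qorbit q (pt s t) y <-> exists i, y = pt (s (+) odd i) (t * q ^ i).
Proof.
move=> odd_h; rewrite qorbitE; split=> [[i [] ->] | [i ->]]; last by exists i; left.
  by exists i.
exists (h + i)%N; rewrite pt_opp; congr pt.
by rewrite oddD odd_h /=; case: s (odd i) => [] [].
Qed.

Lemma qorbit_even_half s t y : ~~ odd h ->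
  qorbit q (pt s t) y <-> exists s' i, y = pt s' (t * q ^ i).
Proof.
move=> even_h; rewrite qorbitE; split=> [[i [] ->] | [s' [i ->]]].
- by do 2!eexists.
- by rewrite pt_opp; do 2!eexists.
have [e | ne] := eqVneq s' (s (+) odd i); first by exists i; left; rewrite e.
(* Inversion followed by the [q ^ h]-power map negates the exponent twice but flips the sign once,
   since [h] is even. *)
exists (h + i)%N; right; rewrite pt_opp.
rewrite (_ : ~~ s (+) (true && odd (h + i)) = s'); last first.
  by rewrite oddD (negPf even_h) /=; case: s s' (odd i) ne => [] [] [].
apply: (pt_eq _ eta_prim); rewrite 2!expnD !mulnA -[LHS]modnMml -[RHS]modnMml.
congr (_ * _ %% _)%N; rewrite -mulnA -[RHS]modnMmr -{1}[t]muln1 -[LHS]modnMmr.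
congr (_ * _ %% _)%N; apply/esym/eqP; rewrite mulnn eqn_mod_dvd ?expn_gt0 ?odd_gt0 //.
by rewrite -(exp1n 2) subn_sqr dvdn_mull.
Qed.

End TwistedOrbits.

Lemma uniq_catI (T : eqType) (r1 r2 : seq T) : uniq r1 -> uniq r2 ->
  (forall x, x \in r1 -> x \in r2 -> False) -> uniq (r1 ++ r2).
Proof.
move=> u1 u2 dis; rewrite cat_uniq u1 u2 andbT; apply/hasPn => x x2.
by apply/negP => /dis; apply.
Qed.

(** * The four cases, with [L], [eta] and a square root [c] of -1 given *)

Section Cases.
Variables (F : finFieldType) (p s l m n : nat).
Hypotheses (p_prime : prime p) (p_odd : odd p) (cardF : #|F| = (p ^ s)%N).
Hypotheses (l_prime : prime l) (l_odd : odd l) (lp : l != p) (m_gt0 : (0 < m)%N).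
Variables (L : fieldType) (h : {rmorphism F -> L}) (eta c : L).
Local Notation q := (p ^ s)%N.
Local Notation k := (l ^ m)%N.
Local Notation N := (2 * l ^ m * p ^ n)%N.
Local Notation f := (ordn l q).
Local Notation M := (Mpoly eta k q).
Local Notation NN := (Mpoly eta k (q ^ 2)).
Local Notation pt := (tpoint eta c).
Local Notation pts := (tpoints eta c k).
Hypotheses (eta_prim : k.-primitive_root eta) (c_sqr : c ^+ 2 = -1).
Variables (e : nat) (rh : nat -> nat).
Hypothesis rh0 : rh 0%N = 0%N.
Hypothesis rh_lt : forall i, (i <= e)%N -> (rh i < k)%N.
Hypothesis rh_distinct : forall i j, (i <= e)%N -> (j <= e)%N ->
  rh i \in cyc k q (rh j) -> i = j.
Hypothesis rh_cover : forall t, (t < k)%N -> exists2 i, (i <= e)%N & t \in cyc k q (rh i).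

Let q_odd : odd q. Proof. by rewrite oddX p_odd orbT. Qed.
Let k_odd : odd k. Proof. by rewrite oddX l_odd orbT. Qed.
Let k_gt0 : (0 < k)%N. Proof. exact: odd_gt0. Qed.
Let coql : coprime q l.
Proof. by rewrite coprimeXl // prime_coprime // dvdn_prime2 // eq_sym. Qed.
Let coqk : coprime q k. Proof. exact: coprimeXr. Qed.
Let coqk2 : coprime (q ^ 2) k. Proof. exact: coprimeXl. Qed.
Let coqd : coprime q (2 * k).*2.
Proof. by rewrite -muln2 mulnAC !coprimeMr coqk coprimen2 q_odd. Qed.

Let neg1_neq1 : (-1 : L) != 1.
Proof.
have chL : p \in [pchar L] by rewrite (fmorph_pchar h) (card_finPcharP cardF).
rewrite eq_sym -addr_eq0 -(natrD _ 1 1) -(dvdn_pcharf chL).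
by rewrite dvdn_prime2 //; apply: contraTneq p_odd => ->.
Qed.

Let ptI := pt_inj k_odd eta_prim c_sqr neg1_neq1.
Let pt_modk t s' t' := @pt_eq L eta c k eta_prim s' t t'.
Let mem_ptsP s' q0 t y := @mem_pts L eta c k k_odd eta_prim s' q0 t y.
Let uniq_ptsP s' q0 t := @uniq_pts L eta c k k_odd eta_prim c_sqr neg1_neq1 s' q0 t.
Let prod_ptsE s' q0 t := @prod_pts L eta c k c_sqr s' q0 t.
Let rhI := rh_eq k_gt0 coqk rh_lt rh_distinct.
Let rhC := rh_cov k_gt0 coqk rh_cover.

Lemma pt_codes (K : choiceType) (idx : seq K) (sg : K -> bool) (tm : K -> nat)
  (B : K -> seq L) :
  uniq idx -> (forall z, z \in idx -> uniq (B z)) ->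
  (forall z, z \in idx -> forall y, y \in B z <-> qorbit q (pt (sg z) (tm z)) y) ->
  (forall z z', z \in idx -> z' \in idx ->
     qorbit q (pt (sg z) (tm z)) (pt (sg z') (tm z')) -> z = z') ->
  (forall s' t, exists2 z, z \in idx & qorbit q (pt (sg z) (tm z)) (pt s' t)) ->
  (forall C : {set 'rV[F]_N}, LCD_negacyclic C <->
     exists g : {poly F}, (exists eps : K -> nat,
       (forall z, eps z \in [:: 0%N; (p ^ n)%N]) /\
       map_poly h g = \prod_(z <- idx) block B z ^+ eps z) /\ C = gen_code N g) /\
  #|[set C : {set 'rV[F]_N} | LCD_negacyclic C]| = (2 ^ size idx)%N.
Proof.
move=> u_idx u_B m_B dist cov.
have d_gt0 : (0 < 2 * k)%N by rewrite muln_gt0.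
have r_b z : z \in idx -> pt (sg z) (tm z) ^+ (2 * k) = -1.
  by move=> _; apply: pt_root.
have cov' (x : L) : x ^+ (2 * k) = -1 -> exists2 z, z \in idx & qorbit q (pt (sg z) (tm z)) x.
  by case/(pt_surj k_odd eta_prim c_sqr) => s' [t ->]; apply: cov.
have uO := uniq_all_pts k_odd eta_prim c_sqr neg1_neq1.
have sO := size_all_pts eta c k.
have rO := root_all_pts k_odd eta_prim c_sqr.
split.
  exact: (LCD_negacyclicP h p_prime cardF q_odd d_gt0 coqd uO sO rO
    u_idx u_B m_B r_b dist cov').
exact: (card_LCD_negacyclic h _ p_prime cardF q_odd d_gt0 coqd uO sO rO
  u_idx u_B m_B r_b dist cov').
Qed.

Let pts_sign s1 s2 q1 q2 t1 t2 x : coprime q1 k -> coprime q2 k ->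
  x \in pts s1 q1 t1 -> x \in pts s2 q2 t2 -> s1 = s2.
Proof.
move=> co1 co2 /(mem_ptsP _ _ _ co1)[i ->] /(mem_ptsP _ _ _ co2)[j].
by case/ptI.
Qed.

(** Only inversion changes the sign, so an orbit is a coset with one sign together with the opposite
    coset with the other: one orbit per coset. *)
Lemma untwisted_case : c ^+ q = c ->
  let P := fun eps : nat -> nat => \prod_(i < e.+1)
     (hatp (scalX (M (rh i)) c) ^+ eps i * hatp (scalX (M (negm k (rh i))) (- c)) ^+ eps i) in
  (forall C : {set 'rV[F]_N}, LCD_negacyclic C <->
     exists g : {poly F}, (exists eps : nat -> nat,
       (forall i, eps i \in [:: 0%N; (p ^ n)%N]) /\ map_poly h g = P eps) /\
       C = gen_code N g) /\
  #|[set C : {set 'rV[F]_N} | LCD_negacyclic C]| = (2 ^ e.+1)%N.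
Proof.
move=> c_frob P; have c_frob1 : c ^+ q = (-1) ^+ false * c by rewrite mul1r.
have orbE := qorbit_pt k_odd q_odd eta_prim c_sqr c_frob1.
pose B i := pts false q (rh i) ++ pts true q (negm k (rh i)).
have [] := @pt_codes nat (iota 0 e.+1) xpred0 rh B.
- exact: iota_uniq.
- move=> i _; apply: uniq_catI; rewrite ?uniq_ptsP // => x x1 x2.
  by have := pts_sign coqk coqk x1 x2.
- move=> i _ y; rewrite orbE mem_cat; split=> [/orP[] /(mem_ptsP _ _ _ coqk)[j ->] | [j]].
  + by exists j; left.
  + by exists j; right.
  + by case=> ->; apply/orP; [left | right]; apply/(mem_ptsP _ _ _ coqk); exists j.
- move=> i i'; rewrite !mem_iota !ltnS /= => ie i'e /orbE[j [] /ptI[] // _ eq].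
  by rewrite (rhI i'e ie eq).
- have cov0 t : exists2 i, i \in iota 0 e.+1 & qorbit q (pt false (rh i)) (pt false t).
    have [i ie [j ti]] := rhC t; exists i; first by rewrite mem_iota.
    by apply/orbE; exists j; left; apply: pt_modk.
  case=> t; last exact: cov0.
  (* A point with sign [true] is the inverse of the point with sign [false] at the opposite
     exponent. *)
  have [i ie H] := cov0 (negm k t); exists i => //.
  have := qorbit_inv H; rewrite (pt_inv k_odd eta_prim c_sqr) /=; congr qorbit.
  apply: pt_modk; apply/eqP; rewrite eq_sym eq_negm // addnC negm_add //.
rewrite size_iota => LCDP ->; split=> // C; rewrite LCDP.
have prodE eps : \prod_(i <- iota 0 e.+1) block B i ^+ eps i = P eps.
  rewrite -[iota _ _]/(index_iota 0 e.+1) big_mkord; apply: eq_bigr => i _.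
  by rewrite /block big_cat /= !prod_ptsE exprMn.
by split=> -[g [[eps [h1 h2]] ->]]; exists g; split=> //; exists eps; rewrite h2 prodE.
Qed.

Lemma prod_pt0 : \prod_(x <- [:: pt false 0; pt true 0]) ('X - x%:P) = 'X^2 + 1.
Proof.
rewrite !big_cons big_nil mulr1 /tpoint expr0 expr1 mul1r mulN1r !mulr1 polyCN opprK.
rewrite mulrDr !mulrBl -expr2 addrA -polyCM [_ * 'X]mulrC subrK -[_ * _]expr2 exprVn c_sqr.
by rewrite invrN1 polyCN opprK.
Qed.

Let uniq_pt0 : uniq [:: pt false 0; pt true 0].
Proof. by rewrite /= inE andbT; apply/eqP => /ptI[]. Qed.

Section Twisted.
Hypothesis c_frob : c ^+ q = - c.

Section EvenOrder.
Hypothesis f_even : ~~ odd f.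

Let hh := (f./2 * l ^ m.-1)%N.
Let odd_hh : odd hh = odd f./2.
Proof. by rewrite oddM oddX l_odd orbT andbT. Qed.
Let q_hh : (k %| q ^ hh + 1)%N.
Proof. exact: (ordn_half_lift l_prime l_odd m_gt0 coql f_even). Qed.

(** Powers of [q] fixing a nonzero class have exponents divisible by the even number [f]. The parity
    of the exponent, and with it the sign, is thus well defined along a nonzero coset. *)
Let even_stab t j j' : ~~ (k %| t)%N -> t * q ^ j = t * q ^ j' %[mod k] -> odd j = odd j'.
Proof.
move=> nt; wlog le_jj' : j j' / (j <= j')%N.
  by move=> H; case: (leqP j j') => [/H // | /ltnW/H H' /esym/H'].
move=> ejj'; have : (f %| j' - j)%N.
  apply: (@ordn_dvd_fixed l l_prime q m coql (t * q ^ j)).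
    by rewrite Gauss_dvdl // coprime_sym coprimeXl.
  by rewrite -mulnA -expnD subnKC.
by move/dvdnP=> [z ez]; rewrite -(subnK le_jj') oddD ez oddM (negPf f_even) andbF.
Qed.

(** Even powers of [q] sweep a coset of [q ^ 2] with the initial sign [z.2], odd powers the other
    half with the opposite sign. The flag [false] gives the zeros of S, [true] those of T. *)
Let B2 (z : nat * bool) :=
  pts z.2 (q ^ 2) (rh z.1) ++ pts (~~ z.2) (q ^ 2) ((rh z.1 * q) %% k)%N.

Let mem_B2 z y : y \in B2 z <-> exists j, y = pt (z.2 (+) odd j) (rh z.1 * q ^ j).
Proof.
rewrite mem_cat; split=> [/orP[] /(mem_ptsP _ _ _ coqk2)[j ->] | [j ->]].
- by exists (2 * j)%N; rewrite oddM addbF -[((q ^ 2) ^ _)%N]expnM.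
- exists (2 * j).+1; rewrite /= oddM addbT; apply: pt_modk.
  by rewrite modnMml -mulnA -[((q ^ 2) ^ _)%N]expnM expnS.
apply/orP; have := odd_double_half j; rewrite -mul2n.
case: (odd j) => /= ej; [right | left]; apply/(mem_ptsP _ _ _ coqk2); exists j./2.
  rewrite addbT; apply: pt_modk.
  by rewrite modnMml -mulnA -[((q ^ 2) ^ _)%N]expnM -expnS -{1}ej.
by rewrite addbF -[((q ^ 2) ^ _)%N]expnM -{1}ej.
Qed.

Let uniq_B2 z : uniq (B2 z).
Proof.
apply: uniq_catI; rewrite ?uniq_ptsP // => x x1 x2.
by have := pts_sign coqk2 coqk2 x1 x2; case: (z.2).
Qed.

Let prod_B2_0 : \prod_(x <- B2 (0%N, false)) ('X - x%:P) = 'X^2 + 1.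
Proof. by rewrite /B2 /= rh0 mul0n mod0n /tpoints cyc0 // prod_pt0. Qed.

Lemma twisted_even_odd_case : odd f./2 ->
  let S := fun i => hatp (scalX (NN (rh i)) c) * hatp (scalX (NN ((rh i * q) %% k)%N) (- c)) in
  let T := fun i => hatp (scalX (NN (rh i)) (- c)) * hatp (scalX (NN ((rh i * q) %% k)%N) c) in
  let P := fun (eps0 : nat) (eps eps' : nat -> nat) =>
    ('X^2 + 1) ^+ eps0 * \prod_(1 <= i < e.+1) (S i ^+ eps i * T i ^+ eps' i) in
  (forall C : {set 'rV[F]_N}, LCD_negacyclic C <->
     exists g : {poly F}, (exists (eps0 : nat) (eps eps' : nat -> nat),
       eps0 \in [:: 0%N; (p ^ n)%N] /\ (forall i, eps i \in [:: 0%N; (p ^ n)%N]) /\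
       (forall i, eps' i \in [:: 0%N; (p ^ n)%N]) /\
       map_poly h g = P eps0 eps eps') /\ C = gen_code N g) /\
  #|[set C : {set 'rV[F]_N} | LCD_negacyclic C]| = (2 ^ (1 + 2 * e))%N.
Proof.
move=> odd_f2 S T P.
have orbE s' t y := qorbit_odd_half k_odd q_odd eta_prim c_sqr c_frob q_hh
  s' t y (etrans odd_hh odd_f2).
pose tl := [seq (i, b) | i <- index_iota 1 e.+1, b <- [:: false; true]].
(* Nonzero cosets carry one orbit per sign; over zero the two points share an orbit, so a single
   index is kept. *)
pose idx := (0%N, false) :: tl.
have idxP z : z \in idx <-> (z.1 <= e)%N /\ (z.1 = 0%N -> z.2 = false).
  rewrite inE; split=> [/predU1P[-> // | /allpairsP[[i b] [hi _ ->]]] | [ze z0]].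
    by move: hi; rewrite /= mem_index_iota ltnS => /andP[i0 ie]; split=> // i1; rewrite i1 in i0.
  apply/predU1P; case: (posnP z.1) => [z1 | z1]; [left | right].
    by move: z1 (z0 z1); case: (z) => ? ? /= -> ->.
  apply/allpairsP; exists z; rewrite mem_index_iota z1 ltnS ze; split=> //; last by case: (z).
  by case: (z.2).
have [] := @pt_codes (nat * bool)%type idx snd (fun z => rh z.1) B2.
- rewrite /idx cons_uniq allpairs_uniq ?iota_uniq //; last by move=> [? ?] [? ?] _ _ [-> ->].
  rewrite andbT; apply/negP=> /allpairsP[[i b] [hi _ [i0 _]]].
  by move: hi; rewrite /= -i0 mem_index_iota.
- by move=> z _; apply: uniq_B2.
- by move=> z _ y; rewrite mem_B2 orbE.
- move=> [i b] [i' b'] /idxP[/= ie i0] /idxP[/= i'e i'0] /orbE[j /ptI[eb eq]].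
  have ii' := rhI i'e ie eq; rewrite ii' in i'0 i'e eq *; rewrite eb; congr (_, _).
  case: (posnP i) => [i1 | i1]; first by rewrite -eb i0 // i'0.
  have ndv := rh_ndvd k_gt0 coqk rh0 rh_lt rh_distinct i1 ie.
  by rewrite -(@even_stab (rh i) 0 j ndv) ?addbF // muln1.
- move=> s' t; have [i ie [u tu]] := rhC t.
  case: (posnP i) => [i0 | i0].
    exists (0%N, false); first by rewrite mem_head.
    (* Over zero the exponent only sets the sign. *)
    apply/orbE; exists (nat_of_bool s'); rewrite /= oddb; apply: pt_modk.
    by rewrite tu i0 rh0 !mul0n.
  exists (i, s' (+) odd u); first by apply/idxP; split=> //= i1; rewrite i1 in i0.
  by apply/orbE; exists u; rewrite /= addbK; apply: pt_modk.
have -> : size idx = (1 + 2 * e)%N.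
  by rewrite /idx /= /tl size_allpairs size_iota subn1 mulnC.
move=> LCDP ->; split=> // C; rewrite LCDP.
have prodE (eps : nat * bool -> nat) : \prod_(z <- idx) block B2 z ^+ eps z =
    P (eps (0%N, false)) (fun i => eps (i, false)) (fun i => eps (i, true)).
  rewrite big_cons /block prod_B2_0 big_allpairs; congr (_ * _); apply: eq_bigr => i _.
  by rewrite !big_cons big_nil /= mulr1 !big_cat /= !prod_ptsE.
split=> -[g [H ->]]; exists g; split=> //.
  case: H => eps [epsP eg].
  exists (eps (0%N, false)), (fun i => eps (i, false)), (fun i => eps (i, true)).
  by rewrite eg prodE.
case: H => eps0 [eps [eps' [eps0P [epsP [eps'P eg]]]]].
(* The exponent at index 0 is independent of [eps 0] and [eps' 0], which the product over [1 <= i]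
   never reads. *)
exists (fun z => if z.1 == 0%N then eps0 else if z.2 then eps' z.1 else eps z.1).
split; first by move=> z; case: ifP => // _; case: ifP.
rewrite eg prodE; congr (_ * _); apply: eq_big_nat => i /andP[i0 _].
by rewrite /= gtn_eqF.
Qed.

Lemma twisted_even_even_case : ~~ odd f./2 ->
  let S := fun i => hatp (scalX (NN (rh i)) c) * hatp (scalX (NN ((rh i * q) %% k)%N) (- c)) in
  let T := fun i => hatp (scalX (NN (rh i)) (- c)) * hatp (scalX (NN ((rh i * q) %% k)%N) c) in
  let P := fun (eps0 : nat) (eps : nat -> nat) =>
    ('X^2 + 1) ^+ eps0 * \prod_(1 <= i < e.+1) (S i ^+ eps i * T i ^+ eps i) in
  (forall C : {set 'rV[F]_N}, LCD_negacyclic C <->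
     exists g : {poly F}, (exists (eps0 : nat) (eps : nat -> nat),
       eps0 \in [:: 0%N; (p ^ n)%N] /\ (forall i, eps i \in [:: 0%N; (p ^ n)%N]) /\
       map_poly h g = P eps0 eps) /\ C = gen_code N g) /\
  #|[set C : {set 'rV[F]_N} | LCD_negacyclic C]| = (2 ^ (1 + e))%N.
Proof.
move=> even_f2 S T P.
have even_hh : ~~ odd hh by rewrite odd_hh.
have orbE s' t y := qorbit_even_half k_odd q_odd eta_prim c_sqr c_frob q_hh s' t y even_hh.
(* Over zero both [B2] lists contain the same two points, so concatenating them would repeat
   roots. *)
pose B i := if i == 0%N then [:: pt false 0; pt true 0] else B2 (i, false) ++ B2 (i, true).
have [] := @pt_codes nat (iota 0 e.+1) xpred0 rh B.
- exact: iota_uniq.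
- move=> i; rewrite mem_iota /= ltnS /B => ie; case: eqP => [_ | /eqP]; first exact: uniq_pt0.
  rewrite -lt0n => i0; apply: uniq_catI => // x /mem_B2[j ->] /mem_B2[j' /ptI[eb eq]].
  have ndv := rh_ndvd k_gt0 coqk rh0 rh_lt rh_distinct i0 ie.
  by move: eb; rewrite (even_stab ndv eq) /=; case: (odd j').
- move=> i _ y; rewrite orbE /B; case: eqP => [-> | _].
    rewrite rh0 !inE; split=> [/orP[] /eqP-> | [s' [j ->]]].
    + by exists false, 0%N.
    + by exists true, 0%N.
    + by rewrite mul0n; case: s'; rewrite eqxx ?orbT.
  rewrite mem_cat; split=> [/orP[] /mem_B2[j ->] | [s' [j ->]]]; try by do 2!eexists.
  apply/orP; case E: (s' (+) odd j); [right | left]; apply/mem_B2; exists j; congr pt.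
    by rewrite -E addbK.
  by rewrite -E addbK.
- move=> i i'; rewrite !mem_iota !ltnS /= => ie i'e /orbE[s' [j /ptI[_ eq]]].
  by rewrite (rhI i'e ie eq).
- move=> s' t; have [i ie [u tu]] := rhC t; exists i; first by rewrite mem_iota.
  by apply/orbE; exists s', u; apply: pt_modk.
rewrite size_iota => LCDP ->; split=> // C; rewrite LCDP.
have prodE eps : \prod_(i <- iota 0 e.+1) block B i ^+ eps i = P (eps 0%N) eps.
  rewrite /= big_cons /block {1}/B eqxx prod_pt0; congr (_ * _).
  rewrite (_ : iota 1 e = index_iota 1 e.+1); last by rewrite /index_iota subn1.
  apply: eq_big_nat => i /andP[i0 _].
  by rewrite /B gtn_eqF // !big_cat /= !prod_ptsE exprMn.
split=> -[g [H ->]]; exists g; split=> //.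
  by case: H => eps [epsP eg]; exists (eps 0%N), eps; rewrite eg prodE.
case: H => eps0 [eps [eps0P [epsP eg]]].
exists (fun i => if i == 0%N then eps0 else eps i).
split; first by move=> i; case: ifP.
rewrite eg prodE; congr (_ * _); apply: eq_big_nat => i /andP[i0 _].
by rewrite /= gtn_eqF.
Qed.

End EvenOrder.

Lemma twisted_odd_case (g0 : nat) : coprime g0 l -> ordn k g0 = totient k -> odd f ->
  let delta := fun r => (totient (l ^ r) %/ ordn (l ^ r) q)%N in
  let I := fun r j => let t := ((l ^ (m - r) * g0 ^ j) %% k)%N in
    hatp (scalX (M t) c) * hatp (scalX (M t) (- c)) in
  let J := fun r j => let t := negm k (l ^ (m - r) * g0 ^ j) in
    hatp (scalX (M t) c) * hatp (scalX (M t) (- c)) in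
  let P := fun (eps0 : nat) (eps : nat -> nat -> nat) =>
    ('X^2 + 1) ^+ eps0 * \prod_(1 <= r < m.+1) \prod_(0 <= j < (delta r)./2)
      (I r j ^+ eps r j * J r j ^+ eps r j) in
  (forall C : {set 'rV[F]_N}, LCD_negacyclic C <->
     exists g : {poly F}, (exists (eps0 : nat) (eps : nat -> nat -> nat),
       eps0 \in [:: 0%N; (p ^ n)%N] /\ (forall r j, eps r j \in [:: 0%N; (p ^ n)%N]) /\
       map_poly h g = P eps0 eps) /\ C = gen_code N g) /\
  #|[set C : {set 'rV[F]_N} | LCD_negacyclic C]| = (2 ^ (1 + e./2))%N.
Proof.
move=> cog g_prim odd_f delta I J P.
pose rp := rep l m g0; pose Z := rep_idx l m q.
have rpU := rep_unique l_prime l_odd m_gt0 cog g_prim coql odd_f.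
have rpN := rep_opp l_prime l_odd m_gt0 cog g_prim coql odd_f.
have rpC := rep_cover l_prime l_odd m_gt0 cog g_prim coql odd_f.
(* The pairs (r, j) represent half of the nonzero cosets, so [e] is twice their number; this gives
   the count with [e./2]. *)
have eZ := count_cosets k_gt0 coqk rh0 rh_lt rh_distinct rh_cover (uniq_rep_idx l m q) rpU rpN rpC.
have odd_u : odd (f * l ^ m.-1) by rewrite oddM odd_f oddX l_odd orbT.
have q_u : q ^ (f * l ^ m.-1) = 1 %[mod k].
  by apply/eqP; rewrite eqn_mod_dvd ?ordn_lift // expn_gt0 odd_gt0.
have orbE s' t y := qorbit_odd_period k_odd q_odd eta_prim c_sqr c_frob s' t y odd_u q_u.
have Z_gt0 z : z \in Z -> (z.1 == 0%N) = false.
  by rewrite mem_rep_idx => /and3P[z0 _ _]; rewrite gtn_eqF.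
(* No coset of a representative is its own opposite, so the I part and the J part of a block have no
   common root. *)
have rpNN z i j : z \in Z -> rp z * q ^ i = negm k (rp z) * q ^ j %[mod k] -> False.
  move=> zZ /esym/(coset_sym k_gt0 coqk)[v]; rewrite -mulnA -expnD negm_mul // => /eqP.
  by rewrite eq_negm // (negPf (rpN _ _ _ zZ zZ)).
have rp_ndvd z : z \in Z -> ~~ (k %| rp z)%N.
  by move=> zZ; apply: contra (rpN z z 0%N zZ zZ) => kz; rewrite muln1 dvdn_add.
pose tm (z : nat * nat) := if z.1 == 0%N then 0%N else rp z.
pose B (z : nat * nat) := if z.1 == 0%N then [:: pt false 0; pt true 0] else
  (pts false q (rp z %% k)%N ++ pts true q (rp z %% k)%N) ++
  (pts false q (negm k (rp z)) ++ pts true q (negm k (rp z))).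
(* The first components in [Z] are at least 1, so [(0, 0)] is free to stand for the zero coset. *)
pose idx := (0%N, 0%N) :: Z.
have mem_modP s' t y : y \in pts s' q (t %% k)%N <-> exists i, y = pt s' (t * q ^ i).
  by rewrite mem_ptsP //; split=> -[i ->]; exists i; apply: pt_modk; rewrite modnMml.
have [] := @pt_codes (nat * nat)%type idx xpred0 tm B.
- by rewrite /= uniq_rep_idx andbT; apply/negP => /Z_gt0.
- move=> z; rewrite inE /B => /predU1P[-> // | zZ]; rewrite Z_gt0 //.
  have uniq_signs t : uniq (pts false q t ++ pts true q t).
    by apply: uniq_catI; rewrite ?uniq_ptsP // => x x1 x2; have := pts_sign coqk coqk x1 x2.
  apply: uniq_catI => //.
  move=> x; rewrite !mem_cat => /orP[] /mem_modP[i ->] /orP[] /(mem_ptsP _ _ _ coqk)[j /ptI[] // _];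
  exact: rpNN.
- move=> z; rewrite inE => /predU1P[-> | zZ] y; rewrite orbE /tm /B.
    rewrite eqxx !inE; split=> [/orP[] /eqP-> | [s' [i []]]].
    + by exists false, 0%N; left.
    + by exists true, 0%N; left.
    + by rewrite mul0n => ->; case: s'; rewrite eqxx ?orbT.
    + by rewrite /negm mod0n subn0 modnn mul0n => ->; case: s'; rewrite eqxx ?orbT.
  rewrite Z_gt0 // !mem_cat.
  split=> [/orP[/orP[] /mem_modP[i ->] | /orP[] /(mem_ptsP _ _ _ coqk)[i ->]] | [s' [i []->]]].
  + by exists false, i; left.
  + by exists true, i; left.
  + by exists false, i; right.
  + by exists true, i; right.
  + by apply/orP; left; apply/orP; case: s'; [right | left]; apply/mem_modP; exists i.
  + by apply/orP; right; apply/orP; case: s'; [right | left]; apply/(mem_ptsP _ _ _ coqk); exists i.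
- have negm0 : negm k 0 = 0%N by rewrite /negm mod0n subn0 modnn.
  have tmZ z : z \in Z -> tm z = rp z by move=> zZ; rewrite /tm Z_gt0.
  move=> z z'; rewrite !inE => zi z'i /orbE[s' [i H]].
  case/predU1P: zi H => [-> | zZ]; case/predU1P: z'i => [-> // | z'Z] H.
  + have : (k %| tm z')%N; last by rewrite tmZ // (negPf (rp_ndvd _ z'Z)).
    by case: H => /ptI[_]; rewrite /dvdn => ->; rewrite [tm _]/= ?negm0 mul0n mod0n.
  + have : (k %| rp z)%N; last by rewrite (negPf (rp_ndvd _ zZ)).
    have co_qi : coprime k (q ^ i) by rewrite coprime_sym coprimeXl.
    rewrite -(Gauss_dvdl _ co_qi); case: H => /ptI[_]; rewrite (tmZ _ zZ) [tm _]/=.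
      by rewrite mod0n => e0; rewrite /dvdn -e0.
    by rewrite negm_mul // => /eqP; rewrite eq_negm.
  + case: H => /ptI[_]; rewrite !tmZ // => e0; first by rewrite (rpU _ _ _ z'Z zZ e0).
    move/eqP: e0; rewrite negm_mul // eq_negm //.
    by rewrite (negPf (rpN _ _ _ z'Z zZ)).
- move=> s' t; have [kt | nkt] := boolP (k %| t)%N.
    exists (0%N, 0%N); first by rewrite mem_head.
    apply/orbE; exists s', 0%N; left; apply: pt_modk.
    by rewrite (eqP kt) mul0n mod0n.
  have [] := rpC (t %% k)%N; [by rewrite lt0n | by rewrite ltn_mod |].
  move=> z zZ [i H]; exists z; first by rewrite inE zZ orbT.
  apply/orbE; exists s', i; rewrite /tm Z_gt0 //.
  case: H => H; [left | right]; apply: pt_modk; first by rewrite -H modn_mod.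
  by apply/eqP; rewrite negm_mul // eq_negm // /dvdn -modnDml.
rewrite /= => LCDP ->; split; last by rewrite eZ doubleK.
move=> C; rewrite LCDP.
have prodE (eps : nat * nat -> nat) : \prod_(z <- idx) block B z ^+ eps z =
    P (eps (0%N, 0%N)) (fun r j => eps (r, j)).
  rewrite big_cons /block {1}/B eqxx prod_pt0 big_allpairs_dep; congr (_ * _).
  apply: eq_big_nat => r /andP[r0 _]; apply: eq_bigr => j _.
  by rewrite /B gtn_eqF // !big_cat /= !prod_ptsE exprMn.
split=> -[g [H ->]]; exists g; split=> //.
  by case: H => eps [epsP eg]; exists (eps (0%N, 0%N)), (fun r j => eps (r, j)); rewrite eg prodE.
case: H => eps0 [eps [eps0P [epsP eg]]].
exists (fun z => if z.1 == 0%N then eps0 else eps z.1 z.2).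
split; first by move=> z; case: ifP.
rewrite eg prodE; congr (_ * _); apply: eq_big_nat => r /andP[r0 _]; apply: eq_bigr => j _.
by rewrite /= gtn_eqF.
Qed.

End Twisted.

End Cases.

Theorem theorem4p5
  (F : finFieldType) (p q s l m n : nat)
  (Hp : prime p) (Hpodd : odd p) (Hs : (0 < s)%N) (Hq : q = (p ^ s)%N)
  (HF : #|F| = q)
  (Hl : prime l) (Hlodd : odd l) (Hlp : l != p)
  (Hm : (0 < m)%N) (Hn : (0 < n)%N)
  (* extension field containing eta (and theta, varsigma) *)
  (L : fieldType) (iota : {rmorphism F -> L})
  (eta : L) (Heta : (l ^ m)%N.-primitive_root eta)
  (* representatives rho_0 = 0, rho_1, ..., rho_e of the q-cyclotomic cosets mod l^m *)
  (e : nat) (rho : seq nat)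
  (Hrho_size : size rho = e.+1)
  (Hrho0 : nth 0%N rho 0 = 0%N)
  (Hrho_lt : forall i, (i <= e)%N -> (nth 0%N rho i < l ^ m)%N)
  (Hrho_distinct : forall i j, (i <= e)%N -> (j <= e)%N ->
      nth 0%N rho i \in cyc (l ^ m) q (nth 0%N rho j) -> i = j)
  (Hrho_cover : forall t, (t < l ^ m)%N ->
      exists2 i, (i <= e)%N & t \in cyc (l ^ m) q (nth 0%N rho i))
  (* g0 : a fixed generator of (Z / l^m Z)^* *)
  (g0 : nat) (Hg0 : coprime g0 l) (Hg0ord : ordn (l ^ m) g0 = totient (l ^ m)) :
  let N := (2 * l ^ m * p ^ n)%N in
  let f := ordn l q in
  let M := Mpoly eta (l ^ m) q in
  let NN := Mpoly eta (l ^ m) (q ^ 2) in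
  let delta := fun r => (totient (l ^ r) %/ ordn (l ^ r) q)%N in
  let rh := fun i => nth 0%N rho i in
  let neg := negm (l ^ m) in
  let pn := (p ^ n)%N in
  (* (i) *)
  ((q %% 4 = 1)%N ->
   forall gamma beta : F,
     gamma ^+ 2 = -1 -> beta ^+ (l ^ m) * gamma = 1 -> beta^-1 = - beta ->
     let P := fun eps : nat -> nat =>
       \prod_(i < e.+1)
         (hatp (scalX (M (rh i)) (iota beta)) ^+ eps i *
          hatp (scalX (M (neg (rh i))) (- iota beta)) ^+ eps i) in
     (forall C : {set 'rV[F]_N},
        LCD_negacyclic C <->
        exists g : {poly F},
          (exists eps : nat -> nat, (forall i, eps i \in [:: 0%N; pn]) /\
             map_poly iota g = P eps) /\ C = gen_code N g)
     /\ #|[set C : {set 'rV[F]_N} | LCD_negacyclic C]| = (2 ^ e.+1)%N)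
  /\
  (forall varsigma theta : L,
     (q %% 4 = 3)%N ->
     varsigma ^+ 2 = -1 -> theta ^+ (l ^ m) * varsigma = 1 ->
     theta^-1 = theta ^+ q -> theta ^+ q = - theta ->
     let X2p1 : {poly L} := 'X^2 + 1 in
     (* (ii) *)
     (odd f ->
      let I := fun r k =>
        let t := ((l ^ (m - r) * g0 ^ k) %% l ^ m)%N in
        hatp (scalX (M t) theta) * hatp (scalX (M t) (- theta)) in
      let J := fun r k =>
        let t := neg (l ^ (m - r) * g0 ^ k)%N in
        hatp (scalX (M t) theta) * hatp (scalX (M t) (- theta)) in
      let P := fun (eps0 : nat) (eps : nat -> nat -> nat) =>
        X2p1 ^+ eps0 *
        \prod_(1 <= r < m.+1) \prod_(0 <= k < (delta r)./2)
           (I r k ^+ eps r k * J r k ^+ eps r k) in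
      (forall C : {set 'rV[F]_N},
         LCD_negacyclic C <->
         exists g : {poly F},
           (exists (eps0 : nat) (eps : nat -> nat -> nat),
              eps0 \in [:: 0%N; pn] /\ (forall r k, eps r k \in [:: 0%N; pn]) /\
              map_poly iota g = P eps0 eps) /\ C = gen_code N g)
      /\ #|[set C : {set 'rV[F]_N} | LCD_negacyclic C]| = (2 ^ (1 + e./2))%N)
     /\
     (* (iii) *)
     ((f %% 4 = 2)%N ->
      let S := fun k => hatp (scalX (NN (rh k)) theta) *
                        hatp (scalX (NN ((rh k * q) %% l ^ m)%N) (- theta)) in
      let T := fun k => hatp (scalX (NN (rh k)) (- theta)) *
                        hatp (scalX (NN ((rh k * q) %% l ^ m)%N) theta) in
      let P := fun (eps0 : nat) (eps eps' : nat -> nat) =>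
        X2p1 ^+ eps0 * \prod_(1 <= k < e.+1) (S k ^+ eps k * T k ^+ eps' k) in
      (forall C : {set 'rV[F]_N},
         LCD_negacyclic C <->
         exists g : {poly F},
           (exists (eps0 : nat) (eps eps' : nat -> nat),
              eps0 \in [:: 0%N; pn] /\ (forall k, eps k \in [:: 0%N; pn]) /\
              (forall k, eps' k \in [:: 0%N; pn]) /\
              map_poly iota g = P eps0 eps eps') /\ C = gen_code N g)
      /\ #|[set C : {set 'rV[F]_N} | LCD_negacyclic C]| = (2 ^ (1 + 2 * e))%N)
     /\
     (* (iv) *)
     ((f %% 4 = 0)%N ->
      let S := fun k => hatp (scalX (NN (rh k)) theta) *
                        hatp (scalX (NN ((rh k * q) %% l ^ m)%N) (- theta)) in
      let T := fun k => hatp (scalX (NN (rh k)) (- theta)) *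
                        hatp (scalX (NN ((rh k * q) %% l ^ m)%N) theta) in
      let P := fun (eps0 : nat) (eps : nat -> nat) =>
        X2p1 ^+ eps0 * \prod_(1 <= k < e.+1) (S k ^+ eps k * T k ^+ eps k) in
      (forall C : {set 'rV[F]_N},
         LCD_negacyclic C <->
         exists g : {poly F},
           (exists (eps0 : nat) (eps : nat -> nat),
              eps0 \in [:: 0%N; pn] /\ (forall k, eps k \in [:: 0%N; pn]) /\
              map_poly iota g = P eps0 eps) /\ C = gen_code N g)
      /\ #|[set C : {set 'rV[F]_N} | LCD_negacyclic C]| = (2 ^ (1 + e))%N)).
Proof.
subst q; move=> N f M NN delta rh neg pn; split.
  move=> _ gamma beta _ beta_gamma betaV.
  have beta0 : beta != 0.
    apply: contra_eqN beta_gamma => /eqP->.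
    by rewrite expr0n expn_eq0 (gtn_eqF (prime_gt0 Hl)) mul0r eq_sym oner_eq0.
  (* The relation [beta^-1 = - beta] says that beta^2 = -1; the same holds for [theta] below. *)
  have beta_sqr : iota beta ^+ 2 = -1.
    by rewrite -rmorphXn -[-1](rmorphN1 iota) expr2 -[X in X * _]opprK -betaV mulNr mulVf.
  apply: (untwisted_case n Hp Hpodd HF Hl Hlodd Hlp iota Heta beta_sqr
    Hrho_lt Hrho_distinct Hrho_cover).
  (* Elements coming from [F] are fixed by the [q]-power map. *)
  by rewrite -rmorphXn -HF expf_card.
move=> varsigma theta _ _ theta_sig thetaV theta_frob X2p1.
have theta0 : theta != 0.
  apply: contra_eqN theta_sig => /eqP->.
  by rewrite expr0n expn_eq0 (gtn_eqF (prime_gt0 Hl)) mul0r eq_sym oner_eq0.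
have theta_sqr : theta ^+ 2 = -1.
  by rewrite expr2 -[X in X * _]opprK -theta_frob -thetaV mulNr mulVf.
(* This lets [lia] translate the residue of [f] modulo 4 into the parities of [f] and [f./2]. *)
have f_half : f = (odd f + f./2.*2)%N by rewrite odd_double_half.
split; first exact: (twisted_odd_case n Hp Hpodd HF Hl Hlodd Hlp Hm iota Heta theta_sqr
  Hrho0 Hrho_lt Hrho_distinct Hrho_cover theta_frob Hg0 Hg0ord).
split=> f4.
  have f_even : ~~ odd f by lia.
  apply: (twisted_even_odd_case n Hp Hpodd HF Hl Hlodd Hlp Hm iota Heta theta_sqr
    Hrho0 Hrho_lt Hrho_distinct Hrho_cover theta_frob f_even); lia.
have f_even : ~~ odd f by lia.
apply: (twisted_even_even_case n Hp Hpodd HF Hl Hlodd Hlp Hm iota Heta theta_sqr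
  Hrho0 Hrho_lt Hrho_distinct Hrho_cover theta_frob f_even); lia.
Qed.
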